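(* Let $d\ge 1$ and $n=4(2^d-1)$. Then $\dim_{\mathbb F_2}(QP_5)_n$ equals $45$ for $d=1$, $190$ for $d=2$, $480$ for $d=3$, $650$ for $d=4$, and $651$ for every $d\ge 5$.
   Context: $P_5=\mathbb F_2[x_1,\dots,x_5]$ with each $x_i$ of degree $1$, a module over the mod-2 Steenrod algebra $\mathcal A$; $\mathcal A^+$ is the augmentation ideal and $QP_5=P_5/\mathcal A^+P_5$. $(QP_5)_n$ is the degree-$n$ part of $QP_5$. *)

(* Defs.v *)
From HB Require Import structures.
From mathcomp Require Import all_boot all_order all_algebra.
Set Implicit Arguments. Unset Strict Implicit. Unset Printing Implicit Defensive.
Import GRing.Theory.
Local Open Scope ring_scope.

(* Monomials x1^(e 0) ... x5^(e 4) of degree n in P_5 = F_2[x1,...,x5],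
   encoded by their exponent vectors e (each exponent is <= n). *)
Definition Mon (n : nat) : finType :=
  {e : {ffun 'I_5 -> 'I_n.+1} | (\sum_(j < 5) val (e j))%N == n}.

(* The degree-n homogeneous part (P_5)_n, as the F_2-vector space of
   F_2-valued functions on the monomial basis (coefficient vectors). *)
Definition Pdeg (n : nat) : vectType 'F_2 := {ffun Mon n -> GRing.regular 'F_2}.

(* Action of the Steenrod squares on monomials, via the Cartan formula and
   Sq^i(x^a) = C(a,i) x^(a+i):  for a monomial x^a of degree k <= n,
   Sq^(n-k)(x^a) = sum over monomials x^b of degree n of
   (prod_j C(a_j, b_j - a_j)) x^b  (terms with some b_j < a_j vanish). *)
Definition Sq_mon (n k : nat) (a : Mon k) : Pdeg n :=
  [ffun b : Mon n =>
     ((\prod_(j < 5)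
         ((val (val a j) <= val (val b j))%N *
          'C(val (val a j), val (val b j) - val (val a j))))%N)%:R].

(* (A^+ P_5)_n : the span of all Sq^i(f) with i >= 1 and f of degree n - i
   (A^+ is spanned by nonempty products of Sq^i, i >= 1, hence
    A^+ P_5 = sum_{i>=1} Sq^i P_5); it suffices to let f range over monomials. *)
Definition AplusP (n : nat) : {vspace Pdeg n} :=
  (\sum_(k < n) <<[seq Sq_mon n a | a <- enum (Mon k)]>>)%VS.

Definition dimQP5 (n : nat) : nat :=
  (\dim (fullv : {vspace Pdeg n}) - \dim (AplusP n))%N.

(* Main.v *)
(** Dually, [(QP_5)_n] is the space of functionals [phi] on [(P_5)_n] fixed by
    the transpose of the total square [Sq].  Put [n_D = 4 (2^(D+1) - 1)], so that
    [n_(D+1) = 2 n_D + 4].  Since [Sq (x + x^2 + x^4 + ...) = x], such a [phi] in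
    degree [n_(D+1)] vanishes on every monomial having at most two odd exponents,
    because [2^(D+3) - 1] is not a sum of at most two powers of 2.  Hence [phi] is
    given by the five functionals [phi^i (y) = phi (X_i y^2)] of degree [n_D],
    [X_i] being the product of the variables other than [x_i], and the only
    conditions are that the [phi^i] are fixed by the transpose of [Sq] and that
    [sum_i phi^i (x_i v) = 0] for all [v].

    Iterating down to degree 4 attaches a functional to each word of length [D]
    in the five letters.  The conditions give [phi^ik = phi^ki] and
    [phi^iik = phi^kki], so that only the set of letters of the word matters: the
    solutions are the families [psi_U] on [(P_5)_4], indexed by the supports [U]
    of words of length [D], such that [sum_i psi_(U+i) (x_i w) = 0] for all [w]
    whenever [#|U| < D].  This linear system does not depend on [D >= 6], and its
    rank is computed by elimination for [D <= 6]. *)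

From Stdlib Require Import PArith FMapPositive.
From HB Require Import structures.
Require Import Defs.
From mathcomp Require Import all_boot all_order all_algebra.
From mathcomp Require Import mxabelem zify.

Set Implicit Arguments.
Unset Strict Implicit.
Unset Printing Implicit Defensive.

(** * The total square on functionals *)

(** A functional on [F_2[x]] is its sequence of values on powers of [x]. This is the transpose of
    multiplication by [x + x^2], the total square of [x], so [sq1 g a] is [g] evaluated on
    [(x + x^2)^a]. *)
Definition shift_sq (g : nat -> bool) (b : nat) : bool := g b.+1 (+) g b.+2.

Definition sq1 (g : nat -> bool) (a : nat) : bool := iter a shift_sq g 0.

Lemma iter_shift_sq_ext a (g h : nat -> bool) :
  g =1 h -> iter a shift_sq g =1 iter a shift_sq h.
Proof. by move=> e; elim: a => //= a IH b; rewrite /shift_sq !IH. Qed.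

Lemma sq1_ext a (g h : nat -> bool) : g =1 h -> sq1 g a = sq1 h a.
Proof. by move=> e; apply: iter_shift_sq_ext. Qed.

Lemma sq1_add a (g h : nat -> bool) :
  sq1 (fun b => g b (+) h b) a = sq1 g a (+) sq1 h a.
Proof.
rewrite /sq1; elim: a 0 => //= a IH b; rewrite /shift_sq !IH.
by rewrite addbACA.
Qed.

Lemma sq1_and a c (g : nat -> bool) :
  sq1 (fun b => c && g b) a = c && sq1 g a.
Proof.
by case: c => //; rewrite /sq1; elim: a 0 => //= a IH b; rewrite /shift_sq !IH.
Qed.

Lemma iter_shift_sq_double w (g : nat -> bool) k :
  iter w.*2 shift_sq g k.*2 = iter w shift_sq (fun k => g k.*2) k.
Proof.
elim: w k => // w IH k; rewrite doubleS 3!iterS /shift_sq -!IH !doubleS.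
by rewrite -addbA; congr (_ (+) _); rewrite addbA addbb.
Qed.

Lemma sq1_double w (g : nat -> bool) :
  sq1 g w.*2 = sq1 (fun k => g k.*2) w.
Proof. exact: (iter_shift_sq_double w g 0). Qed.

Lemma sq1S w (g : nat -> bool) : sq1 g w.+1 = sq1 (shift_sq g) w.
Proof. by rewrite /sq1 iterSr. Qed.

Lemma sq1_doubleS w (g : nat -> bool) :
  sq1 g w.*2.+1 = sq1 (fun k => g k.*2.+1) w (+) sq1 (fun k => g k.*2.+2) w.
Proof. by rewrite sq1S sq1_double -sq1_add. Qed.

Lemma iter_shift_sq_pow2 s (g : nat -> bool) b :
  iter (2 ^ s) shift_sq g b = g (b + 2 ^ s) (+) g (b + 2 ^ s.+1).
Proof.
elim: s g b => [|s IH] g b; first by rewrite /= /shift_sq addn1 addn2.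
have e : 2 ^ s.+1 = 2 ^ s + 2 ^ s by rewrite expnS mul2n addnn.
rewrite {1}e iterD !IH.
have -> : b + 2 ^ s + 2 ^ s = b + 2 ^ s.+1 by lia.
have -> : b + 2 ^ s + 2 ^ s.+1 = b + 2 ^ s.+1 + 2 ^ s by lia.
have -> : b + 2 ^ s.+1 + 2 ^ s.+1 = b + 2 ^ s.+2 by rewrite [2 ^ s.+2]expnS; lia.
by rewrite -addbA; congr (_ (+) _); rewrite addbA addbb.
Qed.

Lemma sq1_pow2 a s (g : nat -> bool) :
  sq1 g (a + 2 ^ s) =
  sq1 (fun b => g (b + 2 ^ s)) a (+) sq1 (fun b => g (b + 2 ^ s.+1)) a.
Proof.
rewrite /sq1 iterD; under iter_shift_sq_ext => b do rewrite iter_shift_sq_pow2.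
exact: sq1_add.
Qed.

Lemma sq1_eq0 a (g : nat -> bool) :
  (forall b, b <= a.*2 -> g b = false) -> sq1 g a = false.
Proof.
move=> g0; suff: forall c b, c <= a -> b <= (a - c).*2 ->
  iter c shift_sq g b = false by move=> /(_ a 0); apply.
elim=> [|c IH] b ca ba /=; first by apply: g0; lia.
by rewrite /shift_sq !IH //; lia.
Qed.

Lemma sq1_top a (g : nat -> bool) :
  (forall b, b < a.*2 -> g b = false) -> sq1 g a = g a.*2.
Proof.
move=> g0; suff: forall c b, c <= a -> b <= (a - c).*2 ->
  iter c shift_sq g b = (b == (a - c).*2) && g a.*2.
  by move=> /(_ a 0); rewrite subnn; apply.
elim=> [|c IH] b ca ba /=.
  rewrite subn0; case: eqP => [->//|ne]; apply: g0; lia.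
by rewrite /shift_sq !IH; lia.
Qed.

(** Pascal's rule for the coefficient of [x^b] in [x^c (x + x^2)^a]. The factor [a <= b] guards
    against truncated subtraction, which would give ['C(a, 0) = 1] for [b < a]. *)
Lemma sq1_coef a b :
  sq1 (fun k => k == b) a = odd ((a <= b) * 'C(a, b - a)).
Proof.
rewrite /sq1; suff: forall c, iter a shift_sq (fun k => k == b) c =
   odd ((a + c <= b) * 'C(a, b - a - c)).
  by move=> ->; rewrite addn0 subn0.
elim: a => [|a IH] c /=.
  rewrite add0n subn0 bin0n.
  by case: leqP => h; case: eqP => ? //=; rewrite ?mul1n ?mul0n; lia.
rewrite /shift_sq !IH.
have [h1|h1] := leqP (a.+1 + c) b; last first.
  have -> : (a + c.+1 <= b) = false by lia.
  by have -> : (a + c.+2 <= b) = false by lia.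
have -> : a + c.+1 <= b by lia.
rewrite !mul1n.
have [h2|h2] := leqP (a + c.+2) b.
  rewrite mul1n (_ : b - a - c.+1 = (b - a - c.+2).+1); last by lia.
  rewrite (_ : b - a.+1 - c = (b - a - c.+2).+1); last by lia.
  by rewrite binS oddD.
rewrite mul0n (_ : b - a - c.+1 = 0); last by lia.
by rewrite (_ : b - a.+1 - c = 0) ?bin0 //; lia.
Qed.

(* [sqT phi a] is the value of the functional [phi] on the total square of
   the monomial with exponents [a]. *)
Fixpoint sqT (phi : seq nat -> bool) (a : seq nat) : bool :=
  if a is x :: r then sq1 (fun b => sqT (fun u => phi (b :: u)) r) x
  else phi [::].

Lemma sqT_ext (f g : seq nat -> bool) a :
  (forall u, size u = size a -> f u = g u) -> sqT f a = sqT g a.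
Proof.
elim: a f g => [|x r IH] f g e /=; first exact: e.
by apply: sq1_ext => b; apply: IH => u su; apply: e; rewrite /= su.
Qed.

Lemma sqT_add (f g : seq nat -> bool) a :
  sqT (fun u => f u (+) g u) a = sqT f a (+) sqT g a.
Proof.
elim: a f g => [|x r IH] f g //=; rewrite -sq1_add.
by apply: sq1_ext => b; rewrite IH.
Qed.

Lemma sqT_and c (f : seq nat -> bool) a :
  sqT (fun u => c && f u) a = c && sqT f a.
Proof.
elim: a f => [|x r IH] f //=; rewrite -sq1_and.
by apply: sq1_ext => b; rewrite IH.
Qed.

Lemma sqT_false a : sqT (fun=> false) a = false.
Proof. exact: (sqT_and false (fun=> false)). Qed.

Lemma sqT_big (I : Type) (s : seq I) (F : I -> seq nat -> bool) a :
  sqT (fun u => \big[addb/false]_(i <- s) F i u) a =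
  \big[addb/false]_(i <- s) sqT (F i) a.
Proof.
elim: s => [|i s IH].
  by rewrite big_nil -[RHS](sqT_false a); apply: sqT_ext => u _; rewrite big_nil.
rewrite big_cons -IH -sqT_add.
by apply: sqT_ext => u _; rewrite big_cons.
Qed.

Definition sq_coef (a b : seq nat) : bool :=
  all2 (fun x y => odd ((x <= y) * 'C(x, y - x))) a b.

Lemma sqT_coef a b : sqT (fun u => u == b) a = sq_coef a b.
Proof.
elim: a b => [|x r IH] [|y b] //=.
  rewrite -[RHS](sq1_eq0 (a := x) (g := fun=> false)) //.
  by apply: sq1_ext => c; rewrite sqT_false.
rewrite -sq1_coef -IH andbC -sq1_and; apply: sq1_ext => c.
by rewrite andbC -sqT_and; apply: sqT_ext => u _; rewrite eqseq_cons.
Qed.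

Lemma sqT_sum (phi : seq nat -> bool) (L : seq (seq nat)) a :
  uniq L -> (forall u, size u = size a -> phi u -> u \in L) ->
  sqT phi a = \big[addb/false]_(b <- L) (sq_coef a b && phi b).
Proof.
move=> uL supp; under eq_bigr => b _ do rewrite -sqT_coef andbC -sqT_and.
rewrite -sqT_big; apply: sqT_ext => u su.
have [uin|nin] := boolP (u \in L).
  rewrite (bigD1_seq u) //= eqxx andbT big1 ?addbF // => v /negbTE.
  by rewrite eq_sym => ->; rewrite andbF.
rewrite big1_seq => [|v /andP[_ vL]]; first by apply: contraNF nin; apply: supp.
by case: eqP vL nin => [->->|]; rewrite ?andbF.
Qed.

Lemma sqT_eq0 (f : seq nat -> bool) a :
  (forall u, size u = size a -> sumn u <= (sumn a).*2 -> f u = false) ->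
  sqT f a = false.
Proof.
elim: a f => [|x r IH] f f0 /=; first exact: f0.
apply: sq1_eq0 => b hb; apply: IH => u su hu.
by apply: f0 => /=; [rewrite su|lia].
Qed.

(** The exponents of [(x + x^2)^a] are at most [2a], so the only term of [Sq] of a monomial in twice
    its degree is its square. *)
Lemma sqT_top (f : seq nat -> bool) a :
  (forall u, size u = size a -> sumn u < (sumn a).*2 -> f u = false) ->
  sqT f a = f (map double a).
Proof.
elim: a f => [|x r IH] f f0 //=.
rewrite sq1_top; first by apply: IH => u su hu; apply: f0 => /=; [rewrite su|lia].
by move=> b hb; apply: sqT_eq0 => u su hu; apply: f0 => /=; [rewrite su|lia].
Qed.

Lemma sq1_high_eq0 a (g : nat -> bool) :
  (forall b, a <= b -> g b = false) -> sq1 g a = false.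
Proof.
move=> g0; suff: forall c b, c <= a -> a - c <= b -> iter c shift_sq g b = false.
  by move=> /(_ a 0); rewrite subnn; apply.
elim=> [|c IH] b ca ba /=; first by apply: g0; lia.
by rewrite /shift_sq !IH //; lia.
Qed.

Lemma sq1_bot a (g : nat -> bool) :
  (forall b, a < b -> g b = false) -> sq1 g a = g a.
Proof.
move=> g0; suff: forall c b, c <= a -> a - c <= b ->
  iter c shift_sq g b = (b == a - c) && g a.
  by move=> /(_ a 0); rewrite subnn; apply.
elim=> [|c IH] b ca ba /=.
  rewrite subn0; case: eqP => [->//|ne]; apply: g0; lia.
by rewrite /shift_sq !IH; lia.
Qed.

Lemma sqT_high_eq0 (f : seq nat -> bool) a :
  (forall u, size u = size a -> sumn a <= sumn u -> f u = false) ->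
  sqT f a = false.
Proof.
elim: a f => [|x r IH] f f0 /=; first exact: f0.
apply: sq1_high_eq0 => b hb; apply: IH => u su hu.
by apply: f0 => /=; [rewrite su|lia].
Qed.

(** Exponents never decrease under [Sq], and the term of lowest degree is the monomial itself. *)
Lemma sqT_bot (f : seq nat -> bool) a :
  (forall u, size u = size a -> sumn a < sumn u -> f u = false) ->
  sqT f a = f a.
Proof.
elim: a f => [|x r IH] f f0 //=.
rewrite sq1_bot; first by apply: IH => u su hu; apply: f0 => /=; [rewrite su|lia].
by move=> b hb; apply: sqT_high_eq0 => u su hu; apply: f0 => /=; [rewrite su|lia].
Qed.

(** * Monomials written as [X^p w^2] *)

Definition comb (p : seq bool) (w : seq nat) : seq nat :=
  [seq nat_of_bool q.1 + q.2.*2 | q <- zip p w].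

Lemma size_comb p w : size p = size w -> size (comb p w) = size w.
Proof. by move=> e; rewrite size_map size2_zip // e. Qed.

Lemma comb_odd_half z : comb (map odd z) (map half z) = z.
Proof. by elim: z => // x z IH; rewrite /comb /= odd_double_half; congr cons. Qed.

(* The parity part of a monomial [X^p w^2] is multiplied out: a variable with
   odd exponent contributes [x + x^2], and [Sq (w^2) = (Sq w)^2]. *)
Fixpoint sq_par (phi : seq nat -> bool) (p : seq bool) (u : seq nat) : bool :=
  match p, u with
  | true :: p', x :: u' => sq_par (fun v => phi (x.*2.+1 :: v)) p' u' (+)
                           sq_par (fun v => phi (x.*2.+2 :: v)) p' u'
  | false :: p', x :: u' => sq_par (fun v => phi (x.*2 :: v)) p' u'
  | _, _ => phi [::]
  end.

Lemma sqT_comb phi p w : size p = size w ->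
  sqT phi (comb p w) = sqT (sq_par phi p) w.
Proof.
elim: w p phi => [|x w IH] [|[] p] //= phi [e].
  rewrite add1n sq1_doubleS -sq1_add; apply: sq1_ext => b.
  by rewrite sqT_add !IH.
by rewrite add0n sq1_double; apply: sq1_ext => b; rewrite IH.
Qed.

(** * Telescoping over powers of two *)

Fixpoint pow_sum N (g : seq nat -> bool) (p : seq bool) (u : seq nat) : bool :=
  match p, u with
  | true :: p', x :: u' =>
      \big[addb/false]_(s < N) pow_sum N (fun v => g (x + 2 ^ s :: v)) p' u'
  | false :: p', x :: u' => pow_sum N (fun v => g (x :: v)) p' u'
  | _, _ => g [::]
  end.

(** [g] on the product of [u] with [x + x^(2^N)] for each selected variable [x]; in [pow_sum] the
    factor is [x + x^2 + ... + x^(2^(N-1))]. *)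
Fixpoint pow_ends N (g : seq nat -> bool) (p : seq bool) (u : seq nat) : bool :=
  match p, u with
  | true :: p', x :: u' => pow_ends N (fun v => g (x + 1 :: v)) p' u' (+)
                           pow_ends N (fun v => g (x + 2 ^ N :: v)) p' u'
  | false :: p', x :: u' => pow_ends N (fun v => g (x :: v)) p' u'
  | _, _ => g [::]
  end.

Lemma sq1_telescope N x (h : nat -> bool) :
  \big[addb/false]_(s < N) sq1 h (x + 2 ^ s) =
  sq1 (fun b => h (b + 1)) x (+) sq1 (fun b => h (b + 2 ^ N)) x.
Proof.
elim: N => [|N IH]; first by rewrite big_ord0 expn0 addbb.
rewrite big_ord_recr /= IH sq1_pow2 -addbA; congr (_ (+) _).
by rewrite addbA addbb.
Qed.

Lemma sq1_big (I : Type) (s : seq I) (F : I -> nat -> bool) x :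
  sq1 (fun b => \big[addb/false]_(i <- s) F i b) x =
  \big[addb/false]_(i <- s) sq1 (F i) x.
Proof.
elim: s => [|i s IH].
  rewrite big_nil (@sq1_ext _ _ (fun=> false)); last by move=> b; rewrite big_nil.
  exact: sq1_eq0.
by rewrite big_cons -IH -sq1_add; apply: sq1_ext => b; rewrite big_cons.
Qed.

Lemma pow_sum_sq1 N (G : nat -> seq nat -> bool) c p u :
  pow_sum N (fun v => sq1 (fun b => G b v) c) p u =
  sq1 (fun b => pow_sum N (G b) p u) c.
Proof.
elim: p u G => [|[] p IH] [|x u] G //=.
rewrite sq1_big; apply: eq_bigr => s _.
exact: (IH u (fun b v => G b (x + 2 ^ s :: v))).
Qed.

(* With [S x = x + x^2 + x^4 + ... + x^(2^(N-1))] the total square of [S x] is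
   [x + x^(2^N)]; here this is applied to every variable selected by [p]. *)
Lemma pow_sum_sqT N (phi : seq nat -> bool) p y : size p = size y ->
  pow_sum N (sqT phi) p y = sqT (pow_ends N phi p) y.
Proof.
elim: y p phi => [|x y IH] [|[] p] phi //= [e]; last first.
  rewrite pow_sum_sq1; apply: sq1_ext => b; exact: IH.
under eq_bigr => s _ do rewrite pow_sum_sq1.
rewrite sq1_telescope -sq1_add; apply: sq1_ext => b.
by rewrite sqT_add !IH.
Qed.

Definition padd (p : seq bool) (u : seq nat) : seq nat :=
  [seq nat_of_bool q.1 + q.2 | q <- zip p u].

Lemma padd_double p u : padd p (map double u) = comb p u.
Proof. by elim: p u => [|a p IH] [|x u] //; congr cons; apply: IH. Qed.

Lemma pow_ends_eq0 N (g : seq nat -> bool) p u :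
  (forall v, g v = false) -> pow_ends N g p u = false.
Proof. by elim: p u g => [|[] p IH] [|x u] g g0 //=; rewrite !IH. Qed.

Lemma pow_ends_padd N (g : seq nat -> bool) p u : size p = size u ->
  (forall v, 2 ^ N <= sumn v -> g v = false) -> pow_ends N g p u = g (padd p u).
Proof.
elim: p u g => [|[] p IH] [|x u] g //= [e] g0; last first.
  by rewrite IH // => v hv; apply: g0 => /=; apply: leq_trans hv (leq_addl _ _).
rewrite [X in _ (+) X]pow_ends_eq0 => [|v]; last by apply: g0 => /=; lia.
rewrite addbF IH //; first by rewrite addnC.
by move=> v hv; apply: g0 => /=; apply: leq_trans hv (leq_addl _ _).
Qed.

Lemma pow_sum_eq0 N (g : seq nat -> bool) p u : size p = size u ->
  (forall s v, size s = count id p -> size v = size u ->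
     sumn v = sumn u + sumn (map (expn 2) s) -> g v = false) ->
  pow_sum N g p u = false.
Proof.
elim: p u g => [|[] p IH] [|x u] g //= e g0.
- exact: (g0 [::]).
- case: e => e; rewrite big1 // => s _; apply: IH => // t v st sv hv.
  by apply: (g0 (val s :: t)) => /=; [rewrite st|rewrite sv|lia].
by case: e => e; apply: IH => // t v st sv hv; apply: (g0 t) => /=; [|rewrite sv|lia].
Qed.

(** * Functionals that vanish on the hit polynomials *)

Definition homog (n : nat) (phi : seq nat -> bool) : Prop :=
  forall z, ~~ ((size z == 5) && (sumn z == n)) -> phi z = false.

(* Functionals on [(P_5)_n], extended by zero, that vanish on the hit
   polynomials: they are the fixed points of the dual total square. *)
Definition annih (n : nat) (phi : seq nat -> bool) : Prop :=
  homog n phi /\ forall z, size z = 5 -> sqT phi z = phi z.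

Lemma homog_deg n phi z : homog n phi -> sumn z != n -> phi z = false.
Proof. by move=> h ne; apply: h; rewrite negb_and ne orbT. Qed.

Lemma sumn_comb p w : size p = size w ->
  sumn (comb p w) = count id p + (sumn w).*2.
Proof.
elim: p w => [|a p IH] [|x w] //= [e].
by rewrite /comb /= -/(comb p w) IH //; lia.
Qed.

(** Evaluate [phi] on the total square of [y] times the sums [x_i + x_i^2 + x_i^4 + ...] over the
    variables selected by [p]. As [phi] is fixed, this is [phi] of the product itself, which by
    hypothesis has no term of degree [n]. After telescoping it is [phi] of [Sq y] times the selected
    variables, where only [y^2] has the right degree. *)
Lemma annih_comb_eq0 n phi p y : annih n phi -> size p = 5 -> size y = 5 ->
  (forall s, size s = count id p -> sumn y + sumn (map (expn 2) s) != n) ->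
  phi (comb p y) = false.
Proof.
move=> [h fx] sp sy ns.
have [e|ne] := eqVneq (sumn (comb p y)) n; last exact: homog_deg ne.
move: e; rewrite sumn_comb ?sp // => e.
have spy : size p = size y by rewrite sp.
(* Truncating at [N = n] suffices: [2^n > n], so a term containing [x_i^(2^n)] lies beyond degree
   [n]. *)
have := @pow_sum_sqT n phi p y spy.
rewrite pow_sum_eq0 // => [|s v ss sv hv]; last first.
  by rewrite fx ?sv //; apply: homog_deg h _; rewrite hv; apply: ns.
rewrite (@sqT_ext _ (fun u => phi (padd p u))) => [|u su]; last first.
  rewrite pow_ends_padd ?su // => v hv; apply: homog_deg h _.
  by have := ltn_expl n (ltnSn 1); lia.
rewrite sqT_top ?padd_double // => u su hu; apply: homog_deg h _.
have : sumn (padd p u) = count id p + sumn u.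
  have : size p = size u by rewrite su.
  elim: (p) (u) => [|a q IH] [|x v] //= [] e'.
  by rewrite /padd /= -/(padd q v) IH //; lia.
lia.
Qed.

(** * Halving the degree *)

Definition deg (D : nat) : nat := 4 * (2 ^ D.+1 - 1).

Lemma degS D : deg D.+1 = (deg D).*2 + 4.
Proof. by rewrite /deg expnS; have := expn_gt0 2 D.+1; lia. Qed.

(** An odd sum of two powers of 2 has a summand 1, and [2^(D+3) - 2] is twice an odd number greater
    than 1. *)
Lemma sum2_pow2_neq D a b : (2 ^ a + 2 ^ b != 2 ^ D.+3 - 1).
Proof.
have pos k : 0 < 2 ^ k by rewrite expn_gt0.
apply/eqP; wlog: a b / a <= b.
  move=> W; have [/W//|/ltnW ba e] := leqP a b.
  by apply: (W b a ba); rewrite addnC.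
case: a => [|a]; case: b => [|b] //; rewrite ?expn0 ?expnS.
- by move=> _; have := pos D; lia.
- case: b => [|b] _; first by have := pos D; lia.
  by rewrite expnS; have := pos D; lia.
by move=> _; have := pos D; lia.
Qed.

Lemma annih_parity D phi z : annih (deg D.+1) phi -> count odd z != 4 ->
  phi z = false.
Proof.
move=> A c4; have [h _] := A.
have [/andP[/eqP sz /eqP dz]|] := boolP ((size z == 5) && (sumn z == deg D.+1));
  last exact: h.
have so : size (map odd z) = size (map half z) by rewrite !size_map.
have dz' := sumn_comb so; move: dz'; rewrite comb_odd_half dz degS => dz'.
have ci : count id (map odd z) = count odd z by rewrite count_map.
have := count_size odd z; rewrite sz ci in dz' * => c5.
rewrite -[z]comb_odd_half; apply: (annih_comb_eq0 A); rewrite ?size_map //.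
rewrite ci => s ss.
have [c0|c2] : count odd z = 0 \/ count odd z = 2 by lia.
  by rewrite c0 in dz' ss; rewrite (size0nil ss) degS /=; lia.
move: ss; rewrite c2; case: s => [|a [|b [|]]] // _.
(* With [n = deg D.+1], a term of degree [n] would require [2^a + 2^b = n / 2 + 1 = 2^(D+3) - 1]. *)
have := sum2_pow2_neq D a b; rewrite /= addn0 degS.
rewrite c2 in dz'; move: dz'; rewrite /deg !expnS.
by have := expn_gt0 2 D; lia.
Qed.

(** * The five derived functionals and their reassembly *)

Definition hat (i : nat) : seq bool := mkseq (fun j => j != i) 5.

Definition der (i : nat) (phi : seq nat -> bool) (y : seq nat) : bool :=
  (size y == 5) && phi (comb (hat i) y).

Lemma derE i phi y : size y = 5 -> der i phi y = phi (comb (hat i) y).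
Proof. by rewrite /der => ->. Qed.

(** The position of the only even exponent is the index [i] for which the monomial is [X_i y^2]. *)
Definition lift5 (f : nat -> seq nat -> bool) (z : seq nat) : bool :=
  [&& size z == 5, count odd z == 4 & f (index false (map odd z)) (map half z)].

(** Here [incr_nth v i] is the monomial [x_i v]. *)
Definition compat (f : nat -> seq nat -> bool) : Prop :=
  forall v, size v = 5 ->
  \big[addb/false]_(i <- iota 0 5) f i (incr_nth v i) = false.

Lemma seq5P (z : seq nat) : size z = 5 ->
  exists a b c d e, z = [:: a; b; c; d; e].
Proof.
case: z => [|a [|b [|c [|d [|e [|]]]]]] // _.
by exists a, b, c, d, e.
Qed.

Lemma der_lift5 f i y : i < 5 -> size y = 5 -> der i (lift5 f) y = f i y.
Proof.
move=> i5 /seq5P[a [b [c [d [e ->]]]]].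
by case: i i5 => [|[|[|[|[|//]]]]] _;
  rewrite derE // /lift5 /comb /= ?add0n ?add1n /= !odd_double /= !uphalf_double !doubleK.
Qed.

Lemma lift5_der D phi z : annih (deg D.+1) phi ->
  lift5 (fun i => der i phi) z = phi z.
Proof.
move=> A; rewrite /lift5; case: eqP => [sz|sz] /=; last first.
  by case: A => h _; rewrite h //; case: eqP.
case: eqP => [c4|/eqP c4] /=; last by rewrite (annih_parity A).
rewrite derE ?size_map // -[z in RHS]comb_odd_half; congr (phi (comb _ _)).
move: c4; case: (seq5P sz) => a [b [c [d [e ->]]]] /=.
by case: (odd a); case: (odd b); case: (odd c); case: (odd d); case: (odd e).
Qed.

Lemma sq_par_ext (f g : seq nat -> bool) p u :
  f =1 g -> sq_par f p u = sq_par g p u.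
Proof.
by elim: p u f g => [|[] p IH] [|x u] f g e //=;
  do ?[congr (_ (+) _)]; apply: IH => v; apply: e.
Qed.

(** In [u^2] times the product of [x_i + x_i^2] over [p], only terms with four odd exponents count.
    With five selected variables exactly one is squared, giving [X_i (x_i u)^2]; with four none is;
    with fewer there is no such term. *)
Lemma sq_par_lift5 f p u : size p = 5 -> size u = 5 ->
  sq_par (lift5 f) p u =
  if all id p then \big[addb/false]_(i <- iota 0 5) f i (incr_nth u i)
  else (count id p == 4) && f (index false p) u.
Proof.
case: p => [|p0 [|p1 [|p2 [|p3 [|p4 [|]]]]]] // _.
move=> /seq5P[a [b [c [d [e ->]]]]].
by case: p0; case: p1; case: p2; case: p3; case: p4;
  rewrite /lift5 /= !odd_double /= ?uphalf_double ?doubleK ?big_cons ?big_nil /=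
    ?addbF //; move: (f 0 _) (f 1 _) (f 2 _) (f 3 _) (f 4 _) => [] [] [] [] [].
Qed.

Lemma size_hat i : size (hat i) = 5. Proof. by rewrite size_mkseq. Qed.

Lemma count_hat i : i < 5 -> count id (hat i) = 4.
Proof. by case: i => [|[|[|[|[|]]]]]. Qed.

Lemma map_odd_comb p w : size p = size w -> map odd (comb p w) = p.
Proof.
elim: p w => [|a p IH] [|x w] // [e]; rewrite /comb /= -/(comb p w) IH //.
by rewrite oddD odd_double addbF oddb.
Qed.

Lemma map_half_comb p w : size p = size w -> map half (comb p w) = w.
Proof.
elim: p w => [|a p IH] [|x w] // [e]; rewrite /comb /= -/(comb p w) IH //.
by rewrite half_bit_double.
Qed.

Lemma lift5_comb f p w : size p = 5 -> size w = 5 ->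
  lift5 f (comb p w) = (count id p == 4) && f (index false p) w.
Proof.
move=> sp sw; rewrite /lift5 size_comb ?sp // sw eqxx /=.
rewrite map_odd_comb ?sp // map_half_comb ?sp //.
by rewrite -(count_map odd id) map_odd_comb ?sp.
Qed.

Lemma index_hat (p : seq bool) : size p = 5 -> count id p = 4 ->
  index false p < 5 /\ p = hat (index false p).
Proof.
by case: p => [|[] [|[] [|[] [|[] [|[] [|]]]]]].
Qed.

Lemma homog_lift5 n f : (forall i, i < 5 -> homog n (f i)) ->
  homog (n.*2 + 4) (lift5 f).
Proof.
move=> h z; apply: contraNF => /and3P[sz c4 fz]; rewrite sz /=.
have so : size (map odd z) = size (map half z) by rewrite !size_map.
have := sumn_comb so; rewrite comb_odd_half count_map (eqP c4) => ->.
have i5 : index false (map odd z) < 5.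
  by apply: (proj1 (index_hat _ _)); rewrite ?size_map ?count_map; apply/eqP.
rewrite addnC; apply/eqP; congr (_.*2 + 4); apply/eqP.
by apply: contraTT fz => ne; rewrite (homog_deg (h _ i5)).
Qed.

(** On the total square of [X^p w^2], five odd exponents leave the compatibility sum, four leave the
    fixed-point condition of one [f i], and fewer leave nothing. *)
Lemma annih_lift5 n f : (forall i, i < 5 -> annih n (f i)) -> compat f ->
  annih (n.*2 + 4) (lift5 f).
Proof.
move=> A C; split; first by apply: homog_lift5 => i /A[].
move=> z sz; rewrite -[z]comb_odd_half.
set p := map odd z; set w := map half z.
have sp : size p = 5 by rewrite size_map.
have sw : size w = 5 by rewrite size_map.
rewrite sqT_comb ?sp // lift5_comb //.
have E u : size u = size w -> sq_par (lift5 f) p u =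
  if all id p then false else (count id p == 4) && f (index false p) u.
  by move=> su; rewrite sq_par_lift5 ?su //; case: ifP => // _; rewrite C ?su.
rewrite (sqT_ext E); case ap: (all id p).
  rewrite sqT_false; case: eqP => //= c4.
  by move: ap; rewrite all_count sp c4.
rewrite sqT_and; case: eqP => //= c4.
by apply: (A _ _).2 => //; apply: (proj1 (index_hat _ _)).
Qed.

Lemma annih_der D phi i : annih (deg D.+1) phi -> i < 5 ->
  annih (deg D) (der i phi).
Proof.
move=> A i5; have [h fx] := A; split=> [z|z sz].
  rewrite negb_and => hz; rewrite /der; case: eqP hz => //= sz hz.
  apply: h; rewrite negb_and; rewrite sumn_comb ?size_hat // count_hat // degS.
  by apply/orP; right; lia.
rewrite derE // -fx ?size_comb ?size_hat // sqT_comb ?size_hat //.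
apply: sqT_ext => u su.
rewrite -(sq_par_ext _ _ (fun z => lift5_der z A)) sq_par_lift5 ?size_hat ?su //.
by case: i i5 => [|[|[|[|[|]]]]].
Qed.

Lemma sumn_incr_nth v i : sumn (incr_nth v i) = (sumn v).+1.
Proof.
by elim: i v => [|i IH] [|x v] //=; rewrite ?IH ?sumn_ncons //=; lia.
Qed.

(** The monomial [x_1...x_5 v^2] has five odd exponents, so [phi] vanishes on it; evaluating [phi]
    on its total square gives [sqT] of the compatibility sum at [v]. That sum lives in the single
    degree [deg D - 1], where [sqT] returns the value itself. *)
Lemma annih_compat D phi : annih (deg D.+1) phi -> compat (fun i => der i phi).
Proof.
move=> A v sv; have [h fx] := A.
set g := fun u => \big[addb/false]_(i <- iota 0 5) der i phi (incr_nth u i).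
have g0 u : (sumn u).+1 != deg D -> g u = false.
  move=> ne; rewrite /g big1_seq // => i /andP[_]; rewrite mem_iota => /= i5.
  by apply: (homog_deg (annih_der A i5).1); rewrite sumn_incr_nth.
have [dv|] := eqVneq (sumn v).+1 (deg D); last exact: g0.
rewrite -/(g v); have <- : sqT g v = g v.
  by apply: sqT_bot => u su hu; apply: g0; rewrite -dv; lia.
have <- : phi (comb (nseq 5 true) v) = false.
  apply: (annih_parity A); rewrite -(count_map odd id) map_odd_comb ?sv //.
rewrite -fx ?size_comb ?sv // sqT_comb ?sv //; apply: sqT_ext => u su.
by rewrite -(sq_par_ext _ _ (fun z => lift5_der z A)) sq_par_lift5 // su.
Qed.

(** Apply compatibility to [v = X^p w^2] with [p] omitting [i] and [k]: for any other [j] the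
    monomial [x_j v] has two odd exponents and [f j] kills it, while [x_i v = X_k w^2] and
    [x_k v = X_i w^2]. *)
Lemma compat_swap D f i k w : (forall j, j < 5 -> annih (deg D.+1) (f j)) ->
  compat f -> i < 5 -> k < 5 -> size w = 5 -> der k (f i) w = der i (f k) w.
Proof.
move=> A C i5 k5 sw; have [->//|ik] := eqVneq i k; rewrite !derE //.
have z0 j z : j < 5 -> count odd z != 4 -> f j z = false.
  by move=> j5; apply: annih_parity (A j j5).
have := C (comb (mkseq (fun j => (j != i) && (j != k)) 5) w).
rewrite size_comb ?size_mkseq // => /(_ sw).
case: (seq5P sw) => a [b [c [d [e ->]]]]; rewrite !big_cons big_nil.
case: i i5 ik => [|[|[|[|[|//]]]]] _; case: k k5 => [|[|[|[|[|//]]]]] _ // _;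
 rewrite /comb /= ?add0n ?add1n;
 do 3!match goal with |- context [f ?j ?z] =>
   rewrite (_ : f j z = false); last by apply: z0; rewrite //= !odd_double
 end; by case: (f _ _); case: (f _ _).
Qed.

(** Take [v = x_1...x_5 w^2]; then [x_i v = X_i (x_i w)^2]. *)
Lemma compat_diag f : compat f -> compat (fun i => der i (f i)).
Proof.
move=> C w sw; have := C (comb (nseq 5 true) w).
rewrite size_comb // => /(_ sw).
by case: (seq5P sw) => a [b [c [d [e ->]]]]; 
rewrite !big_cons !big_nil /der /comb /= ?add0n ?add1n.
Qed.

(** For [x_i v] to have four odd exponents, [v] must have three or five. Three leave two terms,
    equal by the symmetry of [F]; five leave the diagonal sum. *)
Lemma lift5_compat (F : nat -> nat -> seq nat -> bool) :
  (forall i k w, F i k w = F k i w) -> compat (fun i => F i i) ->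
  compat (fun i => lift5 (F i)).
Proof.
move=> sF C v sv; rewrite -[v]comb_odd_half.
have := C (map half v); rewrite size_map => /(_ sv).
case: (seq5P sv) => a [b [c [d [e ->]]]]; rewrite /comb /=.
move: (odd a) (odd b) (odd c) (odd d) (odd e).
move: a./2 b./2 c./2 d./2 e./2 => {a b c d e sv v} a b c d e.
rewrite /lift5.
by do 5!case; rewrite !big_cons !big_nil /= ?add0n ?add1n /= !odd_double /=
  ?uphalf_double ?doubleK ?addbF //= => _; rewrite sF addbb.
Qed.

(** * Words of derivatives *)

Definition ders (I : seq nat) (phi : seq nat -> bool) : seq nat -> bool :=
  foldl (fun g i => der i g) phi I.

Lemma ders_ext I (f g : seq nat -> bool) :
  (forall u, size u = 5 -> f u = g u) ->
  forall u, size u = 5 -> ders I f u = ders I g u.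
Proof.
elim: I f g => [|i I IH] f g e //=; apply: IH => u su.
by rewrite !derE // e // size_comb ?size_hat.
Qed.

Notation letters := (all (fun i : nat => i < 5)).

Lemma annih_ders D phi I : annih (deg (size I + D)) phi -> letters I ->
  annih (deg D) (ders I phi).
Proof.
elim: I phi => [|i I IH] phi //= A /andP[i5 I5].
by apply: IH => //; apply: annih_der.
Qed.

Lemma ders_swap D phi i k I z : annih (deg D.+2) phi -> i < 5 -> k < 5 ->
  size z = 5 -> ders (i :: k :: I) phi z = ders (k :: i :: I) phi z.
Proof.
move=> A i5 k5 sz.
apply: (@ders_ext I (der k (der i phi)) (der i (der k phi))) => // u su.
apply: (@compat_swap D (fun i => der i phi)) => // [j j5|].
  exact: annih_der A j5.
exact: annih_compat A.
Qed.

(** The diagonal family [der j (der j phi)] is compatible as well, and swapping letters there trades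
    [iik] for [kki]. *)
Lemma ders_swap3 D phi i k I z : annih (deg D.+3) phi -> i < 5 -> k < 5 ->
  size z = 5 -> ders (i :: i :: k :: I) phi z = ders (k :: k :: i :: I) phi z.
Proof.
move=> A i5 k5 sz.
apply: (@ders_ext I (der k (der i (der i phi))) (der i (der k (der k phi))))
  => // u su.
apply: (@compat_swap D (fun i => der i (der i phi))) => // [j j5|].
  exact: annih_der (annih_der A j5) j5.
exact: compat_diag (annih_compat A).
Qed.

Lemma ders_rem D phi i J z : annih (deg D) phi -> size J = D -> letters J ->
  i \in J -> size z = 5 -> ders J phi z = ders (i :: rem i J) phi z.
Proof.
elim: D phi J => [|D IH] phi [|j J] //= A [sJ] /andP[j5 J5] iJ sz.
have [->//|ji] := eqVneq j i.
move: iJ; rewrite inE eq_sym (negbTE ji) => /= iJ.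
rewrite -[LHS]/(ders J (der j phi) z) IH //; last exact: annih_der.
case: D A sJ {IH} => [|D] A sJ; first by rewrite (size0nil sJ) in iJ.
by apply: (@ders_swap D) => //; apply: (allP J5).
Qed.

Lemma ders_perm D phi I J z : annih (deg D) phi -> size I = D -> letters I ->
  perm_eq I J -> size z = 5 -> ders I phi z = ders J phi z.
Proof.
elim: D phi I J => [|D IH] phi I J A sI I5 IJ sz.
  move: (perm_size IJ); rewrite sI => /esym/size0nil ->.
  by rewrite (size0nil sI).
case: I sI I5 IJ => [|i I] //= [sI] /andP[i5 I5] IJ.
have iJ : i \in J by rewrite -(perm_mem IJ) mem_head.
have J5 : letters J by rewrite -(perm_all _ IJ) /= i5.
rewrite [RHS](ders_rem A _ J5 iJ) //; last by rewrite -(perm_size IJ) /= sI.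
apply: (IH (der i phi)) => //; first exact: annih_der A i5.
by rewrite -(perm_cons i) (perm_trans IJ) // perm_to_rem.
Qed.

(** * Supports and canonical words *)

Definition mask_of (I : seq nat) : seq bool := mkseq (fun i => i \in I) 5.

Definition elems (U : seq bool) : seq nat := [seq i <- iota 0 5 | nth false U i].

(** For nonempty [U] of size at most [D], the letters of [U] in order with the first one repeated up
    to length [D]. The default letter 0 is reached only for empty [U]. *)
Definition canon (U : seq bool) (D : nat) : seq nat :=
  nseq (D - size (elems U)) (head 0 (elems U)) ++ elems U.

Lemma mem_elems U i : i \in elems U = (i < 5) && nth false U i.
Proof. by rewrite mem_filter mem_iota andbC. Qed.

Lemma uniq_elems U : uniq (elems U).
Proof. by rewrite filter_uniq ?iota_uniq. Qed.

Lemma letters_elems U : letters (elems U).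
Proof. by apply/allP => i; rewrite mem_elems => /andP[]. Qed.

Lemma elems_mask I : letters I -> elems (mask_of I) =i I.
Proof.
move=> I5 i; rewrite mem_elems; have [i5|i5] := ltnP i 5.
  by rewrite nth_mkseq.
by apply/esym/negP => /(allP I5); rewrite ltnNge i5.
Qed.

Lemma eq_mask_of I J : I =i J -> mask_of I = mask_of J.
Proof. by move=> e; rewrite /mask_of /mkseq; apply: eq_map => i; rewrite e. Qed.

(* A repeated letter may be traded for the first letter [u] of the support,
   since [aau] and [uua] act alike; peeling off [u] shortens the word. *)
Lemma ders_canon D phi I z : annih (deg D) phi -> size I = D -> letters I ->
  size z = 5 -> ders I phi z = ders (canon (mask_of I) D) phi z.
Proof.
elim: D phi I => [|D IH] phi I A sI I5 sz; first by rewrite (size0nil sI).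
have peel u J : u = head 0 (elems (mask_of I)) -> size J = D.-1 -> 0 < D ->
    letters J -> u < 5 -> u :: J =i I ->
    ders (u :: u :: J) phi z = ders (canon (mask_of I) D.+1) phi z.
  move=> hu sJ D0 J5 u5 eI; have A' := annih_der A u5.
  rewrite -[LHS]/(ders (u :: J) (der u phi) z) IH //=; last first.
  - by rewrite u5.
  - by rewrite sJ prednK.
  rewrite (eq_mask_of eI) /canon.
  have sE : size (elems (mask_of I)) <= D.
    rewrite -(prednK D0) -sJ -[(size J).+1]/(size (u :: J)).
    apply: uniq_leq_size (uniq_elems _) _ => i.
    by rewrite elems_mask // eI.
  by rewrite subSn // -hu.
have [uI|] := boolP (uniq I).
  apply: (ders_perm A) => //; rewrite /canon (_ : D.+1 - _ = 0) /=.
    apply: uniq_perm (uniq_elems _) _ => // i; by rewrite elems_mask.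
  rewrite -sI (perm_size (s2 := elems (mask_of I))) ?subnn //.
  by apply: uniq_perm (uniq_elems _) _ => // i; rewrite elems_mask.
have uh : head 0 (elems (mask_of I)) \in I.
  rewrite -elems_mask //; case E: (elems _) => [|i s]; last exact: mem_head.
  case: (I) sI I5 E => // i J _ I5 E.
  by have := elems_mask I5 i; rewrite E mem_head.
set u := head 0 _ in uh peel *.
have u5 : u < 5 := allP I5 u uh.
have dup (s : seq nat) : ~~ uniq s -> exists a t, perm_eq s (a :: a :: t).
  elim: s => [|b s IHs] //=; rewrite negb_and negbK.
  case: (boolP (b \in s)) => [bs _|_ /IHs[a [t st]]].
    by exists b, (rem b s); rewrite perm_cons perm_to_rem.
  exists a, (b :: t); rewrite -(perm_cons b) in st.
  apply: perm_trans st _.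
  by have /permPl := perm_catCA [:: b] [:: a; a] t; apply.
move/dup => [a [J IJ]].
have /= := perm_size IJ; rewrite sI => -[sJ].
have : letters [:: a, a & J] by rewrite -(perm_all _ IJ).
case/and3P => a5 _ J5.
rewrite (ders_perm A sI I5 IJ sz).
have [au|au] := eqVneq a u.
  subst a; apply: peel => //; [by rewrite sJ|by rewrite sJ|].
  by move=> i; rewrite (perm_mem IJ) !inE orbA orbb.
have uJ : u \in J.
  by move: uh; rewrite (perm_mem IJ) !inE eq_sym (negbTE au).
have [D' ED] : exists D', D = D'.+2.
  case: (J) uJ sJ => // x J' _ /= ->; by exists (size J').
have sR : size (rem u J) = D'.
  by rewrite size_rem //; move: sJ; rewrite ED => -[<-].
have R5 : letters (rem u J) by apply/allP => i /mem_rem; apply: (allP J5).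
rewrite (@ders_perm _ _ _ [:: a, a, u & rem u J] _ A) //; last first.
- by rewrite !perm_cons perm_to_rem.
- by rewrite /= a5.
- by rewrite /= sJ.
rewrite (@ders_swap3 D') //; last by rewrite -ED.
apply: peel => //=; first by rewrite sR ED.
- by rewrite ED.
- by rewrite a5.
move=> i; rewrite (perm_mem IJ) !inE (perm_mem (perm_to_rem uJ)) inE.
by case: (i == u); case: (i == a).
Qed.

(** * Functionals assembled from families indexed by supports *)

Definition addm (U : seq bool) (i : nat) : seq bool := set_nth false U i true.

Lemma size_addm U i : size U = 5 -> i < 5 -> size (addm U i) = 5.
Proof. by move=> sU i5; rewrite size_set_nth sU; apply/maxn_idPr. Qed.

Lemma nth_addm U i j : nth false (addm U i) j = (j == i) || nth false U j.
Proof. by rewrite nth_set_nth /=; case: eqP. Qed.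

Lemma size_addms U I : size U = 5 -> letters I -> size (foldl addm U I) = 5.
Proof.
elim: I U => [|i I IH] U //= sU /andP[i5 I5]; apply: IH => //.
exact: size_addm.
Qed.

Lemma nth_addms U I j : nth false (foldl addm U I) j = (j \in I) || nth false U j.
Proof.
elim: I U => [|i I IH] U //=; rewrite IH nth_addm inE.
by case: (j == i); case: (j \in I).
Qed.

Lemma addmC U i k : size U = 5 -> i < 5 -> k < 5 ->
  addm (addm U i) k = addm (addm U k) i.
Proof.
move=> sU i5 k5; apply: (@eq_from_nth _ false); first by rewrite !size_addm.
by move=> j _; rewrite !nth_addm; case: (j == i); case: (j == k).
Qed.

Lemma addmm U i : size U = 5 -> i < 5 -> addm (addm U i) i = addm U i.
Proof.
move=> sU i5; apply: (@eq_from_nth _ false); first by rewrite !size_addm.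
by move=> j _; rewrite !nth_addm; case: (j == i).
Qed.

Definition empty5 : seq bool := nseq 5 false.

Lemma addms_empty5 I : letters I -> foldl addm empty5 I = mask_of I.
Proof.
move=> I5; apply: (@eq_from_nth _ false).
  by rewrite size_addms // size_mkseq.
rewrite size_addms // => j j5.
by rewrite nth_addms nth_nseq if_same orbF nth_mkseq.
Qed.

(** Inverse to taking all derivatives along words of length [D]: [U] collects the letters read so
    far, and the functional reached in degree 4 depends only on that set. *)
Fixpoint ext (D : nat) (U : seq bool) (g : seq bool -> seq nat -> bool)
    : seq nat -> bool :=
  if D is D'.+1 then lift5 (fun i => ext D' (addm U i) g) else g U.

Lemma lift5_ext f g z : (forall i u, i < 5 -> size u = 5 -> f i u = g i u) ->
  lift5 f z = lift5 g z.
Proof.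
move=> e; rewrite /lift5; case: eqP => //= sz; case: eqP => //= c4.
apply: e; last by rewrite size_map.
by apply: (proj1 (index_hat _ _)); rewrite ?size_map ?count_map.
Qed.

Lemma ders_of_ext I U g z : letters I -> size z = 5 ->
  ders I (ext (size I) U g) z = g (foldl addm U I) z.
Proof.
elim: I U => [|i I IH] U //= /andP[i5 I5] sz; rewrite -IH //.
by apply: ders_ext sz => u su; rewrite der_lift5.
Qed.

Lemma ext_of_ders D U phi g : annih (deg D) phi ->
  (forall I z, size I = D -> letters I -> size z = 5 ->
     ders I phi z = g (foldl addm U I) z) ->
  forall z, size z = 5 -> phi z = ext D U g z.
Proof.
elim: D U phi => [|D IH] U phi A e z sz; first exact: (e [::]).
rewrite -(lift5_der _ A); apply: lift5_ext => i u i5 su.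
apply: IH => // [|I v sI I5 sv]; first exact: annih_der.
by apply: (e (i :: I)) => //=; rewrite ?sI ?i5.
Qed.

Lemma compat_ext f g : (forall i u, i < 5 -> size u = 5 -> f i u = g i u) ->
  compat f -> compat g.
Proof.
move=> e C v sv; rewrite -[RHS](C v sv); apply: eq_big_seq => i.
by rewrite mem_iota => /= i5; rewrite e // size_incr_nth sv i5.
Qed.

(** Both conditions of [lift5_compat] hold because [U] is a set: adding [i] and [k] commutes, and
    adding [i] twice is adding it once, which turns the diagonal into the induction hypothesis. *)
Lemma ext_compat D U g : size U = 5 -> compat (fun i => g (addm U i)) ->
  compat (fun i => ext D (addm U i) g).
Proof.
move=> sU C; elim: D => [|D IH] //=.
(* Cut off outside the five letters, since symmetry of [F] is asked for all indices. *)
pose F i k u := [&& i < 5, k < 5 & ext D (addm (addm U i) k) g u].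
apply: (@compat_ext (fun i => lift5 (F i))) => [i u i5 su|].
  by apply: lift5_ext => k v k5 _; rewrite /F i5 k5.
apply: lift5_compat => [i k w|].
  by rewrite /F; case: ltnP => i5; case: ltnP => k5 //=; rewrite addmC.
by apply: compat_ext IH => i u i5 _; rewrite /F i5 addmm.
Qed.

Lemma annih_ext D U g : size U = 5 ->
  (forall J, size J = D -> letters J -> annih 4 (g (foldl addm U J))) ->
  (forall J, size J < D -> letters J ->
     compat (fun i => g (addm (foldl addm U J) i))) ->
  annih (deg D) (ext D U g).
Proof.
elim: D U => [|D IH] U sU A C; first exact: (A [::]).
rewrite degS /=; apply: annih_lift5 => [i i5|].
  apply: IH => [|J sJ J5|J sJ J5]; first exact: size_addm.
    by apply: (A (i :: J)) => /=; rewrite ?sJ ?i5.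
  by apply: (C (i :: J)) => /=; rewrite ?i5.
exact: ext_compat (C [::] _ _).
Qed.

Lemma compat_iter D f : (forall i, i < 5 -> annih (deg D) (f i)) -> compat f ->
  compat (fun i => ders (nseq D i) (f i)).
Proof.
elim: D f => [|D IH] f A C //=.
apply: (IH (fun i => der i (f i))); last exact: compat_diag.
by move=> i i5; apply: annih_der => //; apply: A.
Qed.

Definition valid (D : nat) (U : seq bool) : bool :=
  if D == 0 then count id U == 0 else 0 < count id U <= D.

Definition adm (D : nat) (g : seq bool -> seq nat -> bool) : Prop :=
  (forall U, size U = 5 -> valid D U -> annih 4 (g U)) /\
  (forall U, size U = 5 -> count id U < D -> compat (fun i => g (addm U i))).

Lemma size_elems U : size U = 5 -> size (elems U) = count id U.
Proof.
by case: U => [|[] [|[] [|[] [|[] [|[] [|]]]]]].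
Qed.

Lemma mask_elems U : size U = 5 -> mask_of (elems U) = U.
Proof. by case: U => [|[] [|[] [|[] [|[] [|[] [|]]]]]]. Qed.

Lemma count_mask_of I : letters I -> count id (mask_of I) <= size I.
Proof.
move=> I5; rewrite -size_elems ?size_mkseq //.
by apply: uniq_leq_size (uniq_elems _) _ => i; rewrite elems_mask.
Qed.

Lemma valid_mask_of I : letters I -> valid (size I) (mask_of I).
Proof.
move=> I5; rewrite /valid; case: eqP => [/size0nil->//|/eqP s0].
rewrite count_mask_of // andbT -size_elems ?size_mkseq //.
case: I I5 s0 => // i I I5 _.
by case: (elems _) (elems_mask I5 i) => //; rewrite mem_head.
Qed.

Lemma canonP D U : size U = 5 -> valid D U ->
  [/\ size (canon U D) = D, letters (canon U D) & mask_of (canon U D) = U].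
Proof.
move=> sU v.
have sE : size (elems U) <= D.
  rewrite size_elems //; move: v; rewrite /valid; case: eqP => [->/eqP->//|_].
  by case/andP.
have hE : nseq (D - size (elems U)) (head 0 (elems U)) =i [::] \/
  head 0 (elems U) \in elems U.
  case E: (elems U) => [|i s]; last by right; apply: mem_head.
  left; move: v; rewrite /valid -size_elems // E /=.
  by case: eqP => [->|].
have mE : canon U D =i elems U.
  move=> i; rewrite /canon mem_cat; case: hE => [->//|h].
  by rewrite mem_nseq; case: eqP => [->|_]; rewrite ?andbF //= h andbT orbT.
split.
- by rewrite size_cat size_nseq subnK.
- by rewrite (eq_all_r mE) letters_elems.
by rewrite (eq_mask_of mE) mask_elems.
Qed.

Definition canon_ders (D : nat) (phi : seq nat -> bool) (U : seq bool) : seq nat -> bool :=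
  ders (canon U D) phi.

(** For compatibility at a set [U] of size less than [D], spell the letters of [U] once and then
    repeat a single letter [i]. This word has support [U + i], and iterating the diagonal identity
    gives the sum over [i]. *)
Lemma adm_canon_ders D phi : annih (deg D) phi -> adm D (canon_ders D phi).
Proof.
move=> A; split=> U sU.
  move=> /(canonP sU)[sc c5 _].
  by apply: (@annih_ders 0) => //; rewrite sc addn0.
rewrite -size_elems // => cU.
set J := elems U in cU *; have J5 : letters J := letters_elems U.
(* Of the [e.+1] remaining letters, [annih_compat] uses one and [compat_iter] the other [e]. *)
have [e De] : exists e, D = size J + e.+1 by exists (D - (size J).+1); lia.
have AJ : annih (deg e.+1) (ders J phi) by apply: annih_ders; rewrite -?De.
apply: compat_ext (compat_iter _ (annih_compat AJ)) => [i u i5 su|i i5]; last first.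
  exact: annih_der AJ i5.
rewrite /canon_ders -[ders _ (der _ _)]/(ders (nseq e.+1 i) (ders J phi)).
rewrite -[LHS]/(foldl _ _ _ u) -foldl_cat.
have l5 : letters (J ++ nseq e.+1 i) by rewrite all_cat J5 all_nseq i5 orbT.
rewrite -/(ders _ _) (ders_canon A) //; last by rewrite size_cat size_nseq.
congr (ders (canon _ _) _ _); apply: (@eq_from_nth _ false).
  by rewrite size_mkseq size_addm.
rewrite size_mkseq => j j5; rewrite nth_mkseq // nth_addm mem_cat mem_nseq.
by rewrite mem_elems j5 orbC.
Qed.

Lemma canon_ders_ext D g U z : size U = 5 -> valid D U -> size z = 5 ->
  canon_ders D (ext D empty5 g) U z = g U z.
Proof.
move=> sU v sz; rewrite /canon_ders; have [sc c5 mc] := canonP sU v.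
by rewrite -{2}sc ders_of_ext // addms_empty5 // mc.
Qed.

Lemma annih_adm D g : adm D g -> annih (deg D) (ext D empty5 g).
Proof.
case=> A C; apply: annih_ext => // J sJ J5; rewrite addms_empty5 //.
  by apply: A; rewrite ?size_mkseq // -sJ valid_mask_of.
apply: C; first by rewrite size_mkseq.
exact: leq_ltn_trans (count_mask_of J5) sJ.
Qed.

(** * Sparse elimination over the field with two elements *)

Lemma pos_eqbP : Equality.axiom Pos.eqb.
Proof. by move=> p q; apply: (iffP idP) => /Pos.eqb_eq. Qed.

HB.instance Definition _ := hasDecEq.Build positive pos_eqbP.

Definition row_val (x : positive -> bool) (r : seq positive) : bool :=
  \big[addb/false]_(p <- r) x p.

(** Merge of increasing lists in which equal keys cancel, hence a sum modulo 2. The fixpoint is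
    nested because either list may shrink alone. *)
Fixpoint row_xor (r : seq positive) : seq positive -> seq positive :=
  fix row_xor_r (s : seq positive) : seq positive :=
    match r, s with
    | [::], _ => s
    | _, [::] => r
    | p :: r', q :: s' =>
        match Pos.compare p q with
        | Lt => p :: row_xor r' s
        | Gt => q :: row_xor_r s'
        | Eq => row_xor r' s'
        end
    end.

Lemma row_val_xor x r s : row_val x (row_xor r s) = row_val x r (+) row_val x s.
Proof.
rewrite /row_val; elim: r s => [|p r IHr] s /=; first by case: s => *; rewrite big_nil.
elim: s => [|q s IHs]; first by rewrite big_nil addbF.
case: Pos.compare_spec => [->|_|_]; rewrite !big_cons.
- by rewrite IHr addbACA addbb.
- by rewrite IHr big_cons !addbA.
by rewrite IHs big_cons addbCA.
Qed.

Arguments row_xor : simpl never.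

Definition table := PositiveMap.t (seq positive).

(** Rows are stored under their leading key. A new row is reduced by the stored row with the same
    leading key until it is empty or starts a new pivot; [fuel] bounds the number of reductions, and
    [None] signals its exhaustion. *)
Fixpoint insert_row (fuel : nat) (t : table) (r : seq positive) : option table :=
  if r is p :: _ then
    match PositiveMap.find p t with
    | None => Some (PositiveMap.add p r t)
    | Some s => if fuel is f.+1 then insert_row f t (row_xor r s) else None
    end
  else Some t.

Fixpoint insert_rows (fuel : nat) (t : table) (rs : seq (seq positive))
    : option table :=
  if rs is r :: rs' then
    if insert_row fuel t r is Some t' then insert_rows fuel t' rs' else None
  else Some t.

Definition table_sat (x : positive -> bool) (t : table) : Prop :=
  forall p r, PositiveMap.find p t = Some r -> row_val x r = false.

Lemma insert_rowP x fuel t r t' : insert_row fuel t r = Some t' ->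
  table_sat x t' <-> table_sat x t /\ row_val x r = false.
Proof.
elim: fuel t r => [|f IH] t [|p r] //=; try by
  move=> [<-]; split=> [?|[]//]; rewrite /row_val big_nil.
- case E: (PositiveMap.find p t) => [s|] // [<-]; split=> [S|[S rx] q s].
    split=> [q s F|]; last by apply: (S p); rewrite PositiveMap.gss.
    apply: (S q); rewrite PositiveMap.gso // => qp.
    by rewrite -qp F in E.
  case: (Pos.eq_dec q p) => [->|qp]; first by rewrite PositiveMap.gss => -[<-].
  by rewrite PositiveMap.gso //; apply: S.
case E: (PositiveMap.find p t) => [s|].
  move/IH => ->; rewrite row_val_xor; split=> -[S].
    by rewrite (S _ _ E) addbF.
  by move=> ->; rewrite (S _ _ E).
move=> [<-]; split=> [S|[S rx] q s].
  split=> [q s F|]; last by apply: (S p); rewrite PositiveMap.gss.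
  apply: (S q); rewrite PositiveMap.gso // => qp.
  by rewrite -qp F in E.
case: (Pos.eq_dec q p) => [->|qp]; first by rewrite PositiveMap.gss => -[<-].
by rewrite PositiveMap.gso //; apply: S.
Qed.

Lemma insert_rowsP x fuel t rs t' : insert_rows fuel t rs = Some t' ->
  table_sat x t' <-> table_sat x t /\ all (fun r => ~~ row_val x r) rs.
Proof.
elim: rs t => [|r rs IH] t /=; first by move=> [<-]; split=> [|[]].
case E: insert_row => [t1|] // /IH ->; rewrite (insert_rowP x E).
by case: (row_val x r) => /=; split=> [[[]]|[]].
Qed.

Definition key_map (keys : seq positive) : PositiveMap.t unit :=
  foldr (fun k m => PositiveMap.add k tt m) (PositiveMap.empty unit) keys.

Lemma key_mapP keys (p : positive) : PositiveMap.find p (key_map keys) -> p \in keys.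
Proof.
elim: keys => [|k keys IH] /=; first by rewrite PositiveMap.gempty.
rewrite inE; case: (Pos.eq_dec p k) => [->|pk]; first by rewrite eqxx.
by rewrite PositiveMap.gso // => /IH ->; rewrite orbT.
Qed.

(** Checked on the final table, so that no order invariant has to be carried through the
    elimination. *)
Definition triangular (keys : seq positive) (t : table) : bool :=
  let m := key_map keys in
  all (fun pr : positive * seq positive =>
         isSome (PositiveMap.find pr.1 m) &&
         (if pr.2 is q :: r then Pos.eqb q pr.1 && all (Pos.ltb pr.1) r
          else false))
      (PositiveMap.elements t).

Definition is_free (t : table) (k : positive) : bool :=
  ~~ isSome (PositiveMap.find k t).

Definition rank_check (fuel : nat) (keys : seq positive)
    (rs : seq (seq positive)) (k : nat) : bool :=
  if insert_rows fuel (PositiveMap.empty _) rs is Some t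
  then triangular keys t && (count (is_free t) keys == k) else false.

Definition assign (keys : seq positive) (x : {ffun 'I_(size keys) -> bool})
    (p : positive) : bool :=
  if insub (index p keys) is Some i then x i else false.

Lemma assign_nth keys (x : {ffun 'I_(size keys) -> bool}) (i : 'I_(size keys)) :
  uniq keys -> assign x (nth xH keys i) = x i.
Proof. by move=> u; rewrite /assign index_uniq // valK. Qed.

Lemma triangularP keys t p r : triangular keys t ->
  PositiveMap.find p t = Some r ->
  p \in keys /\ exists2 s, r = p :: s & all (Pos.ltb p) s.
Proof.
move=> T Ep; have F := PositiveMap.elements_correct t p Ep.
move: T; rewrite /triangular {Ep}.
elim: (PositiveMap.elements t) F => //= -[q s] e IH [[-> ->]|F] /andP[/= h T];
  last exact: IH.
case/andP: h => /key_mapP pk {IH}; case: r => // a r /andP[/Pos.eqb_eq -> lt].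
by split=> //; exists r.
Qed.

(* Subtracting from each pivot variable the rest of its row is a unitriangular,
   hence bijective, change of variables that turns the system into the vanishing
   of the pivot variables. *)
Theorem rank_checkP fuel keys rs k : uniq keys -> rank_check fuel keys rs k ->
  #|[set x : {ffun 'I_(size keys) -> bool} |
      all (fun r => ~~ row_val (assign x) r) rs]| = 2 ^ k.
Proof.
rewrite /rank_check => uk; case E: insert_rows => [t|] // /andP[T /eqP <-].
pose N := size keys; pose key (i : 'I_N) := nth xH keys i.
pose rest (i : 'I_N) := if PositiveMap.find (key i) t is Some r then behead r
                        else [::].
pose Phi (x : {ffun 'I_N -> bool}) : {ffun 'I_N -> bool} :=
  [ffun i => x i (+) row_val (assign x) (rest i)].
pose F : {pred 'I_N} := [pred i | is_free t (key i)].
have injPhi : injective Phi.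
  move=> x y exy; apply/ffunP => i0; apply/eqP/negPn/negP => ne0.
  (* Among the places where [x] and [y] differ, take the one with the largest key: the rest of its
     row involves only larger keys, where they agree. *)
  case: (@arg_maxnP _ i0 (fun i => x i != y i) (fun i => Pos.to_nat (key i)) ne0).
  move=> i ne mx.
  have /ffunP/(_ i) := exy; rewrite !ffunE => e.
  move/negP: ne; apply; move: e.
  suff -> : row_val (assign x) (rest i) = row_val (assign y) (rest i).
    by move/addIb => ->.
  apply: eq_big_seq => p; rewrite /rest.
  case Ep: (PositiveMap.find _ _) => [r|] //.
  have [_ [s -> /= /allP lt]] := triangularP T Ep.
  move=> /lt /Pos.ltb_lt lp; rewrite /assign.
  case: insubP => // j _ vj.
  have kj : key j = p.
    by rewrite /key vj nth_index // -index_mem -vj; apply: ltn_ord.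
  apply/eqP/negPn/negP => /mx; rewrite kj /= leqNgt => /negP; apply.
  by apply/ltP/Pos2Nat.inj_lt.
have -> : [set x : {ffun 'I_N -> bool} |
      all (fun r => ~~ row_val (assign x) r) rs] =
    Phi @^-1: [set y in pffun_on false F predT].
  apply/setP => x; rewrite !inE.
  have S := insert_rowsP (assign x) E.
  apply/idP/idP => [R|/pffun_onP[/supportP Y _]].
    have {}S : table_sat (assign x) t.
      by apply/S; split=> // p r; rewrite PositiveMap.gempty.
    apply/pffun_onP; split; last by move=> b; rewrite inE.
    apply/supportP => i; rewrite inE negbK /= => Fi.
    rewrite ffunE /rest; case Ei: (PositiveMap.find _ _) Fi => [r|] // _.
    have [_ [s er _]] := triangularP T Ei.
    have := S _ _ Ei; rewrite er /row_val big_cons /= -(assign_nth x i uk).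
    by [].
  have {}S : table_sat (assign x) t -> all (fun r => ~~ row_val (assign x) r) rs.
    by move/S => [].
  apply: S => p r Ep; have [pk [s er _]] := triangularP T Ep.
  have ip : index p keys < N by rewrite index_mem.
  have kp : key (Ordinal ip) = p by rewrite /key /= nth_index.
  have := Y (Ordinal ip); rewrite inE /is_free kp Ep /= => /(_ isT).
  rewrite ffunE /rest kp Ep er /= -(assign_nth x _ uk) -/(key _) kp.
  by rewrite /row_val big_cons.
rewrite on_card_preimset; last exact: onW_bij (injF_bij injPhi).
rewrite cardsE card_pffun_on cardT enumT -enumT -cardE card_bool; congr (2 ^ _).
rewrite -sum1_card -sum1_count (big_nth xH) big_mkord.
by apply: eq_bigl => i; rewrite inE.
Qed.

(** * The linear system in degree 4 *)

Fixpoint monos (k n : nat) : seq (seq nat) :=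
  if k is k'.+1 then
    flatten [seq [seq a :: r | r <- monos k' (n - a)] | a <- iota 0 n.+1]
  else if n == 0 then [:: [::]] else [::].

Fixpoint masks (k : nat) : seq (seq bool) :=
  if k is k'.+1 then map (cons false) (masks k') ++ map (cons true) (masks k')
  else [:: [::]].

Arguments monos : simpl never.
Arguments masks : simpl never.

Definition vars : seq (seq bool * seq nat) :=
  [seq (U, z) | z <- monos 5 4, U <- masks 5].

(* Exponents in degree 4 fit in three bits, so that all keys have the same
   length and are ordered lexicographically. *)
Definition key (v : seq bool * seq nat) : positive :=
  foldl (fun p b => if b then xI p else xO p) xH
    (flatten [seq [:: odd e./2./2; odd e./2; odd e] | e <- v.2] ++ v.1).

Definition keys : seq positive := map key vars.

(** The terms of degree 4 in [Sq a], for [a] of degree below 4. A functional concentrated in degree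
    4 is zero on [a], so being fixed means vanishing on their sum. *)
Definition hit_rows : seq (seq (seq nat)) :=
  [seq [seq b <- monos 5 4 | sq_coef a b] |
    a <- flatten [seq monos 5 k | k <- iota 0 4]].

(** Three groups: [psi_U = 0] when [U] is not the support of a word of length [D], [psi_U] kills the
    hit polynomials of degree 4, and the compatibility relations. The first group allows one set of
    unknowns for all [D]. *)
Definition eqs (D : nat) : seq (seq (seq bool * seq nat)) :=
  [seq [:: (U, z)] | U <- [seq U <- masks 5 | ~~ valid D U], z <- monos 5 4] ++
  [seq [seq (U, b) | b <- h] | U <- [seq U <- masks 5 | valid D U],
                               h <- hit_rows] ++
  [seq [seq (addm U i, incr_nth w i) | i <- iota 0 5] |
    U <- [seq U <- masks 5 | count id U < D], w <- monos 5 3].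

Definition key_row (r : seq (seq bool * seq nat)) : seq positive :=
  foldr (fun v => row_xor [:: key v]) [::] r.

Definition rows (D : nat) : seq (seq positive) := map key_row (eqs D).

Lemma mem_monos k n z : (z \in monos k n) = (size z == k) && (sumn z == n).
Proof.
elim: k n z => [|k IH] n z.
  by case: n z => [|n] [|a z].
rewrite -[monos _ _]/(flatten [seq [seq a :: r | r <- monos k (n - a)] | a <- iota 0 n.+1]).
apply/flatten_mapP/idP => [[a]|].
  rewrite mem_iota add0n /= => an /mapP[r]; rewrite IH => /andP[/eqP sr /eqP hr] ->.
  by rewrite /= sr hr subnKC // !eqxx.
case: z => // a r /andP[sr /eqP hr]; have {}hr : a + sumn r = n := hr.
exists a; first by rewrite mem_iota; lia.
by apply: map_f; rewrite IH -hr addKn eqxx andbT.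
Qed.

Lemma mem_masks k U : (U \in masks k) = (size U == k).
Proof.
elim: k U => [|k IH] [|a U] //; rewrite [masks _]/masks -/masks mem_cat.
  by apply/negP => /orP[] /mapP[].
have inj (b : bool) : injective (cons b) by move=> ? ? [].
have ne (b : bool) : (~~ b :: U \in [seq b :: i | i <- masks k]) = false.
  by apply/negP => /mapP[V _ [/eqP]]; case: b.
by case: a; rewrite (mem_map (@inj _)) ?(ne true) ?(ne false) ?orbF IH.
Qed.

Lemma mem_vars U z :
  ((U, z) \in vars) = [&& size U == 5, size z == 5 & sumn z == 4].
Proof.
rewrite /vars; apply/allpairsPdep/idP => [[w [V [wz VU [-> ->]]]]|/andP[sU sz]].
  by rewrite -mem_masks VU -mem_monos.
by exists z, U; rewrite mem_masks mem_monos.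
Qed.

Lemma uniq_monos : uniq (monos 5 4).
Proof. by vm_compute. Qed.

(** The unknowns are listed in increasing order of their keys, so a linear check of sortedness gives
    distinctness. *)
Lemma uniq_keys : uniq keys.
Proof.
have tr : transitive Pos.ltb.
  by move=> p q r /Pos.ltb_lt qp /Pos.ltb_lt pr; apply/Pos.ltb_lt; lia.
have ir : irreflexive Pos.ltb by move=> p; apply: Pos.ltb_irrefl.
by apply: (sorted_uniq tr ir); vm_compute.
Qed.

Definition sols_dim (D : nat) : nat :=
  if D == 0 then 45 else if D == 1 then 190 else if D == 2 then 480
  else if D == 3 then 650 else 651.

Lemma rank_check_rows :
  all (fun D => rank_check 1000 keys (rows D) (sols_dim D)) (iota 0 7).
Proof. by vm_compute. Qed.

Opaque monos masks.

Lemma row_val_key x r : row_val x (key_row r) = \big[addb/false]_(v <- r) x (key v).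
Proof.
elim: r => [|v r IH]; first by rewrite /row_val !big_nil.
by rewrite /= row_val_xor IH big_cons /row_val big_cons big_nil addbF.
Qed.

Definition system (D : nat) (g : seq bool -> seq nat -> bool) : bool :=
  all (fun r => ~~ \big[addb/false]_(v <- r) g v.1 v.2) (eqs D).

Definition supported (D : nat) (g : seq bool -> seq nat -> bool) : Prop :=
  forall U z, g U z -> ((U, z) \in vars) && valid D U.

(** Only degrees below 4 impose a condition: from degree 4 on, the lowest term of [Sq z] accounts
    for the whole value. *)
Lemma annih4P (h : seq nat -> bool) : homog 4 h ->
  annih 4 h <->
  all (fun r => ~~ \big[addb/false]_(b <- r) h b) hit_rows.
Proof.
move=> hh.
have E a : size a = 5 ->
    sqT h a = \big[addb/false]_(b <- [seq b <- monos 5 4 | sq_coef a b]) h b.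
  move=> sa; rewrite (@sqT_sum h (monos 5 4)).
  - rewrite [RHS]big_filter [RHS]big_mkcond; apply: eq_bigr => b _.
    by case: sq_coef.
  - exact: uniq_monos.
  by move=> u _ hu; rewrite mem_monos; apply: contraTT hu => /hh ->.
split=> [[_ fx]|A].
  apply/allP => _ /mapP[a + ->].
  case/flatten_mapP => k; rewrite mem_iota mem_monos => k4 /andP[/eqP sa /eqP da].
  by rewrite -E // fx // (homog_deg hh) // da; lia.
split=> // z sz; have [dz|dz] := ltnP (sumn z) 4; last first.
  by apply: sqT_bot => u su du; apply: (homog_deg hh); lia.
rewrite E // (homog_deg hh); last by lia.
apply/negbTE/(allP A)/mapP; exists z => //.
by apply/flatten_mapP; exists (sumn z); rewrite ?mem_iota ?mem_monos ?sz ?eqxx.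
Qed.

Lemma systemP D (g : seq bool -> seq nat -> bool) :
  (forall U z, g U z -> (U, z) \in vars) ->
  system D g <-> supported D g /\ adm D g.
Proof.
move=> gv.
have homg U : homog 4 (g U).
  move=> z; apply: contraNF => /gv; rewrite mem_vars.
  by case/and3P => _ -> ->.
rewrite /system /eqs !all_cat; split.
  case/and3P => /allP a1 /allP a2 /allP a3; split; [|split].
  - move=> U z gUz; rewrite (gv _ _ gUz) /=; apply: contraTT gUz => nv.
    case: (boolP ((U, z) \in vars)) => [|nv']; last by apply: contra nv' => /gv.
    rewrite mem_vars => /andP[sU sz].
    have /a1 : [:: (U, z)] \in [seq [:: (U, z)] |
        U <- [seq U <- masks 5 | ~~ valid D U], z <- monos 5 4].
      by apply/allpairsPdep; exists U, z; rewrite mem_filter mem_masks nv sU mem_monos.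
    by rewrite big_cons big_nil addbF.
  - move=> U sU vU; apply/annih4P => //; apply/allP => h hh.
    have /a2 : [seq (U, b) | b <- h] \in [seq [seq (U, b) | b <- h] |
        U <- [seq U <- masks 5 | valid D U], h <- hit_rows].
      by apply/allpairsPdep; exists U, h; rewrite mem_filter mem_masks vU sU eqxx.
    by rewrite big_map.
  move=> U sU cU w sw.
  have [dw|dw] := eqVneq (sumn w) 3; last first.
    rewrite big1_seq // => i _; apply: (homog_deg (homg _)).
    by rewrite sumn_incr_nth eqSS.
  have /a3 : [seq (addm U i, incr_nth w i) | i <- iota 0 5] \in
    [seq [seq (addm U i, incr_nth w i) | i <- iota 0 5] |
    U <- [seq U <- masks 5 | count id U < D], w <- monos 5 3].
    apply/allpairsPdep; exists U, w.
    by rewrite mem_filter mem_masks cU sU mem_monos sw dw.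
  by rewrite big_map => /negbTE.
case=> s [A C]; apply/and3P; split; apply/allP => r /allpairsPdep[U [z []]];
  rewrite mem_filter mem_masks => /andP[vU /eqP sU] hz ->.
- rewrite big_cons big_nil addbF /=; apply: contra vU => /s.
  by case/andP.
- rewrite big_map; have /annih4P - /(_ (homg U)) /allP := A U sU vU.
  exact.
rewrite big_map; move: hz; rewrite mem_monos => /andP[/eqP sz _].
by rewrite (C U sU vU).
Qed.

(** At most five letters are available, so all side conditions on [U] are constant once [D >= 6]. *)
Lemma eqs_stable D : 6 <= D -> eqs D = eqs 6.
Proof.
move=> D6; have c5 U : U \in masks 5 -> count id U <= 5.
  by rewrite mem_masks => /eqP <-; apply: count_size.
have v6 U : U \in masks 5 -> valid D U = valid 6 U.
  by move=> /c5 c; rewrite /valid (_ : (D == 0) = false) /=; lia.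
have e1 : [seq U <- masks 5 | ~~ valid D U] = [seq U <- masks 5 | ~~ valid 6 U].
  by apply: eq_in_filter => U /v6 ->.
have e2 : [seq U <- masks 5 | valid D U] = [seq U <- masks 5 | valid 6 U].
  exact: eq_in_filter.
have e3 : [seq U <- masks 5 | count id U < D] = [seq U <- masks 5 | count id U < 6].
  by apply: eq_in_filter => U /c5 c; lia.
by rewrite /eqs e1 e2 e3.
Qed.

(** * Families as vectors of unknowns *)

Definition sol_of (V : eqType) (v0 : V) (vs : seq V) (ky : V -> positive)
    (g : V -> bool) : {ffun 'I_(size (map ky vs)) -> bool} :=
  [ffun i => g (nth v0 vs (val i))].

Lemma assign_sol_of (V : eqType) (v0 : V) vs ky (g : V -> bool) v :
  uniq (map ky vs) -> v \in vs -> assign (sol_of v0 vs ky g) (ky v) = g v.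
Proof.
move=> uk vv; have iv : index v vs < size (map ky vs) by rewrite size_map index_mem.
have kv : ky v = nth xH (map ky vs) (Ordinal iv).
  by rewrite /= (nth_map v0) ?index_mem // nth_index.
by rewrite kv assign_nth // ffunE /= nth_index.
Qed.

Lemma sol_of_assign (V : eqType) (v0 : V) vs ky
    (x : {ffun 'I_(size (map ky vs)) -> bool}) : uniq (map ky vs) ->
  sol_of v0 vs ky (fun v => (v \in vs) && assign x (ky v)) = x.
Proof.
move=> uk; apply/ffunP => i; rewrite ffunE.
have iv : val i < size vs by rewrite -(size_map ky); apply: ltn_ord.
by rewrite mem_nth //= -(nth_map _ xH) // assign_nth.
Qed.

Definition sol_fam (g : seq bool -> seq nat -> bool) : {ffun 'I_(size keys) -> bool} :=
  sol_of ([::], [::]) vars key (fun v => g v.1 v.2).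

Definition fam_sol (x : {ffun 'I_(size keys) -> bool}) (U : seq bool) (z : seq nat)
  : bool := ((U, z) \in vars) && assign x (key (U, z)).

Lemma fam_solK x : sol_fam (fam_sol x) = x.
Proof.
rewrite -[RHS](sol_of_assign ([::], [::]) x uniq_keys).
by apply/ffunP => i; rewrite !ffunE /fam_sol -surjective_pairing.
Qed.

Lemma sol_famK (g : seq bool -> seq nat -> bool) U z :
  (forall U z, g U z -> (U, z) \in vars) -> fam_sol (sol_fam g) U z = g U z.
Proof.
move=> gv; rewrite /fam_sol.
have [v|nv] := boolP ((U, z) \in vars).
  exact: (assign_sol_of _ _ uniq_keys v).
by apply/esym/negbTE; apply: contra nv => /gv.
Qed.

Definition sols (D : nat) : {set {ffun 'I_(size keys) -> bool}} :=
  [set x | all (fun r => ~~ row_val (assign x) r) (rows D)].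

Lemma mem_vars_eqs D (r : seq (seq bool * seq nat)) (v : seq bool * seq nat) :
  r \in eqs D -> v \in r -> v \in vars.
Proof.
have step U w i : size U = 5 -> size w = 5 -> sumn w = 3 -> i < 5 ->
    (addm U i, incr_nth w i) \in vars.
  move=> sU sw dw i5; rewrite mem_vars size_addm // size_incr_nth sw i5 eqxx /=.
  by rewrite sumn_incr_nth dw.
rewrite /eqs 2!mem_cat => /or3P[] /allpairsPdep[U [z []]];
  rewrite mem_filter mem_masks => /andP[_ sU].
- by rewrite mem_monos => hz ->; rewrite mem_seq1 => /eqP ->; rewrite mem_vars sU.
- move=> /mapP[a _ ->] -> /mapP[b]; rewrite mem_filter mem_monos => /andP[_ hb] ->.
  by rewrite mem_vars sU.
rewrite mem_monos => /andP[/eqP sz /eqP dz] -> /mapP[i]; rewrite mem_iota => i5 ->.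
by apply: step => //; apply/eqP.
Qed.

Lemma mem_sols D x : (x \in sols D) = system D (fam_sol x).
Proof.
rewrite inE /rows all_map /system; apply: eq_in_all => r rD /=.
rewrite row_val_key; congr (~~ _); apply: eq_big_seq => v vr.
by rewrite /fam_sol -surjective_pairing (mem_vars_eqs rD vr).
Qed.

Lemma card_sols D : #|sols D| = 2 ^ sols_dim D.
Proof.
have -> : sols D = sols (minn D 6).
  by rewrite /minn; case: ltnP => // D6; rewrite /sols /rows eqs_stable.
have -> : sols_dim D = sols_dim (minn D 6).
  by case: D => [|[|[|[|[|[|[|D]]]]]]].
apply: rank_checkP uniq_keys _; apply: (allP rank_check_rows).
by rewrite mem_iota; lia.
Qed.

(** * Dimension of the quotient *)

Import GRing.Theory.
Local Open Scope ring_scope.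

Definition pairing (I : finType) (f : {ffun I -> bool})
    (v : {ffun I -> GRing.regular 'F_2}) : GRing.regular 'F_2 :=
  \sum_b (f b)%:R * v b.

Lemma pairing_is_linear (I : finType) (f : {ffun I -> bool}) : linear (pairing f).
Proof.
move=> a u v; rewrite /pairing scaler_sumr -big_split /=.
by apply: eq_bigr => b _; rewrite !ffunE mulrDr mulrCA.
Qed.

HB.instance Definition _ (I : finType) (f : {ffun I -> bool}) :=
  GRing.isLinear.Build 'F_2 {ffun I -> GRing.regular 'F_2} (GRing.regular 'F_2)
    _ (pairing f) (pairing_is_linear f).

(** With a basis of [W] as the rows of [A], the functionals vanishing on [W] are the row vectors
    killed by [A^T], a space of dimension [#|I| - \dim W]; Boolean functions and row vectors over
    [F_2] are the same data. *)
Lemma card_orthogonal (I : finType) (W : {vspace {ffun I -> GRing.regular 'F_2}}) :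
  #|[set f : {ffun I -> bool} | (W <= lker (linfun (pairing f)))%VS]|
    = (2 ^ (#|I| - \dim W))%N.
Proof.
pose X := vbasis W.
pose A : 'M['F_2]_(\dim W, #|I|) := \matrix_(i, j) tnth X i (enum_val j).
have freeA : row_free A.
  apply: inj_row_free => c /rowP cA; apply/rowP => i; rewrite mxE.
  have /freeP fX := basis_free (vbasisP W).
  apply: (fX (fun i => c 0 i)); apply/ffunP => b.
  rewrite sum_ffunE [RHS]ffunE.
  have := cA (enum_rank b); rewrite mxE [RHS]mxE => E; rewrite -[RHS]E.
  apply: eq_bigr => j _; rewrite !mxE enum_rankK ffunE.
  by rewrite (tnth_nth 0).
have rk : \rank (kermx A^T) = (#|I| - \dim W)%N.
  by rewrite mxrank_ker mxrank_tr (eqP freeA).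
have <- : #|rowg (kermx A^T)| = (2 ^ (#|I| - \dim W))%N.
  by rewrite card_rowg rk card_Fp.
pose h (f : {ffun I -> bool}) : 'rV['F_2]_#|I| := \row_j (f (enum_val j))%:R.
have h_inj : injective h.
  move=> f g /rowP e; apply/ffunP => b; have := e (enum_rank b).
  by rewrite !mxE enum_rankK; case: (f b); case: (g b) => // /eqP.
pose h' (u : 'rV['F_2]_#|I|) : {ffun I -> bool} := [ffun b => u 0 (enum_rank b) != 0].
have h'K : cancel h' h.
  move=> u; apply/rowP => j; rewrite !mxE ffunE enum_valK.
  case: (u 0 j) => -[|[|m]] im //=; apply/val_inj => //=.
have bh : bijective h by exists h' => // f; apply: h_inj; rewrite h'K.
rewrite -(on_card_preimset (onW_bij _ bh)); apply: eq_card => f; rewrite !inE.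
apply/idP/sub_kermxP => [/subvP sW|k].
  apply/rowP => i; rewrite !mxE.
  have := sW _ (vbasis_mem (mem_tnth i X)).
  rewrite memv_ker lfunE /= => /eqP; rewrite /pairing (reindex_onto enum_val enum_rank) /=.
    rewrite (eq_bigl xpredT) => [E|j]; last by rewrite enum_valK eqxx.
    by rewrite -[RHS]E; apply: eq_bigr => j _; rewrite !mxE.
  by move=> b _; rewrite enum_rankK.
rewrite -(span_basis (vbasisP W)); apply/span_subvP => v /tnthP[i ->].
rewrite memv_ker lfunE /=; apply/eqP.
have /rowP/(_ i) := k; rewrite !mxE => E.
rewrite -[RHS]E /pairing (reindex_onto enum_val enum_rank) /=.
  rewrite (eq_bigl xpredT) => [|j]; last by rewrite enum_valK eqxx.
  by apply: eq_bigr => j _; rewrite !mxE.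
by move=> b _; rewrite enum_rankK.
Qed.

Lemma dim_Pdeg n : \dim (fullv : {vspace Pdeg n}) = #|Mon n|.
Proof. by rewrite dimvf /dim /= muln1. Qed.

Local Close Scope ring_scope.

(** * Monomials as exponent sequences *)

Definition mon_seq n (a : Mon n) : seq nat :=
  [seq nat_of_ord (val a j) | j <- enum 'I_5].

Lemma size_mon_seq n (a : Mon n) : size (mon_seq a) = 5.
Proof. by rewrite size_map size_enum_ord. Qed.

Lemma sumn_mon_seq n (a : Mon n) : sumn (mon_seq a) = n.
Proof. by rewrite sumnE big_map big_enum; apply/eqP: (valP a). Qed.

Lemma mon_seq_inj n : injective (@mon_seq n).
Proof.
move=> a b /eq_in_map e; apply/val_inj/ffunP => j; apply/val_inj.
by apply: e; rewrite mem_enum.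
Qed.

Lemma mon_seqP n z : size z = 5 -> sumn z = n -> exists a : Mon n, mon_seq a = z.
Proof.
move=> sz dz; pose e : {ffun 'I_5 -> 'I_n.+1} := [ffun j : 'I_5 => inord (nth 0 z j)].
have le j : j < 5 -> nth 0 z j <= n.
  move=> j5; rewrite -dz sumnE (big_nth 0) sz big_mkord (bigD1 (Ordinal j5)) //=.
  exact: leq_addr.
have ve (j : 'I_5) : nat_of_ord (e j) = nth 0 z j by rewrite ffunE inordK // ltnS le.
have se : \sum_(j < 5) val (e j) == n.
  rewrite -[X in _ == X]dz sumnE (big_nth 0) sz big_mkord.
  by apply/eqP/eq_bigr => j _; apply: ve.
exists (exist _ e se); apply: (@eq_from_nth _ 0); rewrite size_mon_seq ?sz //.
move=> j j5; rewrite (nth_map (Ordinal j5)) ?size_enum_ord //= ve.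
by rewrite nth_enum_ord.
Qed.

Definition mon_fun n (f : {ffun Mon n -> bool}) (z : seq nat) : bool :=
  [exists b : Mon n, (mon_seq b == z) && f b].

Lemma mon_fun_seq n (f : {ffun Mon n -> bool}) b : mon_fun f (mon_seq b) = f b.
Proof.
apply/existsP/idP => [[c /andP[/eqP/mon_seq_inj -> //]]|fb].
by exists b; rewrite eqxx.
Qed.

Lemma homog_mon_fun n (f : {ffun Mon n -> bool}) : homog n (mon_fun f).
Proof.
move=> z; apply: contraNF => /existsP[b /andP[/eqP <- _]].
by rewrite size_mon_seq sumn_mon_seq !eqxx.
Qed.

Lemma odd_prod (I : Type) (s : seq I) (F : I -> nat) :
  odd (\prod_(i <- s) F i) = all (fun i => odd (F i)) s.
Proof. by elim: s => [|i s IH]; rewrite ?big_nil // big_cons oddM IH. Qed.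

Lemma odd_sum (I : Type) (s : seq I) (F : I -> nat) :
  odd (\sum_(i <- s) F i) = \big[addb/false]_(i <- s) odd (F i).
Proof. by elim: s => [|i s IH]; rewrite ?big_nil // !big_cons oddD IH. Qed.

Lemma sq_coef_mon k n (a : Mon k) (b : Mon n) :
  sq_coef (mon_seq a) (mon_seq b) =
  odd (\prod_(j < 5) ((val a j <= val b j) * 'C(val a j, val b j - val a j))).
Proof.
rewrite -big_enum /= odd_prod /sq_coef /mon_seq.
by elim: (enum _) => //= j s ->.
Qed.

Lemma pairing_Sq n k (f : {ffun Mon n -> bool}) (a : Mon k) :
  (pairing f (Sq_mon n a) == 0%R) = ~~ sqT (mon_fun f) (mon_seq a).
Proof.
rewrite (@sqT_sum _ [seq mon_seq b | b <- enum (Mon n)]); last first.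
- move=> u _ /existsP[b /andP[/eqP <- _]].
  by apply: map_f; rewrite mem_enum.
- by rewrite map_inj_uniq ?enum_uniq //; apply: mon_seq_inj.
have -> : pairing f (Sq_mon n a) = ((\sum_(b : Mon n) f b *
   \prod_(j < 5) ((val (val a j) <= val (val b j)) *
          'C(val (val a j), val (val b j) - val (val a j)))))%:R%R.
  by rewrite natr_sum; apply: eq_bigr => b _; rewrite ffunE natrM.
rewrite -(dvdn_pcharf (pchar_Fp (isT : prime 2))) dvdn2 big_map big_enum /=.
congr (~~ _); rewrite -(big_enum _ _ _ _) odd_sum big_enum /=.
apply: eq_bigr => b _; rewrite oddM oddb -sq_coef_mon andbC.
by rewrite mon_fun_seq.
Qed.

(** A fixed functional takes on [Sq a] its value on [a], which is zero when [a] has degree below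
    [n], and the degree [n] parts of these [Sq a] span the hit polynomials. From degree [n] on the
    fixed-point condition is automatic. *)
Lemma orthogonal_annih n (f : {ffun Mon n -> bool}) :
  (AplusP n <= lker (linfun (pairing f)))%VS <-> annih n (mon_fun f).
Proof.
split=> [/subv_sumP S|[_ fx]].
  split=> [|z sz]; first exact: homog_mon_fun.
  have [dz|dz] := ltnP (sumn z) n; last first.
    by apply: sqT_bot => u su du; apply: (homog_deg (@homog_mon_fun _ f)); lia.
  have [a <-] := @mon_seqP (Ordinal dz) z sz erefl.
  have /span_subvP/(_ (Sq_mon n a)) := S (Ordinal dz) isT.
  rewrite map_f ?mem_enum // => /(_ isT); rewrite memv_ker lfunE /= pairing_Sq.
  move/negbTE ->; rewrite (homog_deg (@homog_mon_fun _ f)) // sumn_mon_seq /=.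
  by lia.
apply/subv_sumP => k _; apply/span_subvP => v /mapP[a _ ->].
rewrite memv_ker lfunE /= pairing_Sq fx ?size_mon_seq //.
apply/negbT/(homog_deg (@homog_mon_fun _ f)); rewrite sumn_mon_seq.
by have := ltn_ord k; lia.
Qed.

(** * Functionals correspond to solutions of the system *)

Lemma annih_eq n (f g : seq nat -> bool) : homog n g ->
  (forall z, size z = 5 -> f z = g z) -> annih n f -> annih n g.
Proof.
move=> hg e [_ fx]; split=> // z sz; rewrite -e // -fx //.
by apply/esym/sqT_ext => u su; apply: e; rewrite su.
Qed.

Definition fam (D : nat) (phi : seq nat -> bool) (U : seq bool) (z : seq nat) : bool :=
  [&& (U, z) \in vars, valid D U & canon_ders D phi U z].

Lemma famE D phi U z : annih (deg D) phi -> size U = 5 -> valid D U ->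
  size z = 5 -> fam D phi U z = canon_ders D phi U z.
Proof.
move=> A sU vU sz; rewrite /fam vU mem_vars sU sz /=; case: eqP => //= /eqP dz.
by have [A4 _] := adm_canon_ders A; rewrite (homog_deg (A4 U sU vU).1).
Qed.

Lemma valid_addm D U i : size U = 5 -> i < 5 -> count id U < D ->
  valid D (addm U i).
Proof.
case: D => // D; rewrite /valid /= ltnS.
by case: U => [|[] [|[] [|[] [|[] [|[] [|]]]]]] // _;
  case: i => [|[|[|[|[|]]]]] //= _; lia.
Qed.

Lemma system_fam D phi : annih (deg D) phi -> system D (fam D phi).
Proof.
move=> A; have [A4 C] := adm_canon_ders A; apply/systemP => [U z /andP[]//|].
split=> [U z /and3P[-> ->]//|]; split=> U sU.
  move=> vU; apply: annih_eq (A4 U sU vU) => [z|z sz]; last by rewrite famE.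
  by apply: contraNF => /andP[]; rewrite mem_vars => /and3P[_ -> ->].
move=> cU; apply: compat_ext (C U sU cU) => i u i5 su.
by rewrite famE // ?size_addm // valid_addm.
Qed.

Lemma system_eq D g h : (forall U z, g U z = h U z) -> system D g = system D h.
Proof.
move=> e; apply: eq_all => r; congr (~~ _).
by apply: eq_bigr => v _; apply: e.
Qed.

Lemma fam_vars D phi U z : fam D phi U z -> (U, z) \in vars.
Proof. by case/andP. Qed.

(** Dimensions are compared through cardinalities: [b] assembles a functional from a solution, [a]
    takes its derivatives along canonical words, and the two are mutually inverse. *)
Lemma dimQP5_deg D : dimQP5 (deg D) = sols_dim D.
Proof.
apply: (@expnI 2) => //; rewrite -card_sols /dimQP5 dim_Pdeg -card_orthogonal.
set n := deg D; set A := [set f | _].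
pose b (x : {ffun 'I_(size keys) -> bool}) : {ffun Mon n -> bool} :=
  [ffun m => ext D empty5 (fam_sol x) (mon_seq m)].
pose a (f : {ffun Mon n -> bool}) := sol_fam (fam D (mon_fun f)).
have annA f : f \in A -> annih n (mon_fun f) by rewrite inE => /orthogonal_annih.
have solP x : x \in sols D -> supported D (fam_sol x) /\ adm D (fam_sol x).
  rewrite mem_sols => S; apply: (proj1 (systemP _ _) S) => U z.
  by case/andP.
have bE x z : x \in sols D -> mon_fun (b x) z = ext D empty5 (fam_sol x) z.
  move=> /solP[_ /annih_adm [h _]].
  have [/andP[/eqP sz /eqP dz]|nz] := boolP ((size z == 5) && (sumn z == n)).
    by have [m <-] := mon_seqP sz dz; rewrite mon_fun_seq ffunE.
  by rewrite h // homog_mon_fun.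
have bA x : x \in sols D -> b x \in A.
  move=> xs; rewrite inE; apply/orthogonal_annih.
  have [_ /annih_adm] := solP x xs; apply: annih_eq => [|z _]; last by rewrite bE.
  exact: homog_mon_fun.
have aS f : f \in A -> a f \in sols D.
  move=> /annA Af; rewrite mem_sols /a.
  by rewrite (@system_eq _ _ (fam D (mon_fun f))) ?system_fam // => U z;
    apply: sol_famK; apply: fam_vars.
have abK x : x \in sols D -> a (b x) = x.
  move=> xs; rewrite -[RHS]fam_solK; have [sx _] := solP x xs.
  have Ab := annA _ (bA x xs).
  apply/ffunP => i; rewrite !ffunE; set v := nth _ _ _.
  have [vv|nv] := boolP (v \in vars); last first.
    by rewrite /fam /fam_sol -surjective_pairing (negbTE nv).
  move: vv; case: v => U z /= vv; move: (vv); rewrite mem_vars => /and3P[/eqP sU /eqP sz _].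
  have [vU|nU] := boolP (valid D U); last first.
    rewrite /fam (negbTE nU) andbF; apply/esym/negP => /sx.
    by rewrite (negbTE nU) andbF.
  rewrite famE // -(@canon_ders_ext D (fam_sol x)) //.
  by apply: ders_ext => // u _; apply: bE.
(* A functional is determined by its derivatives along words, and these depend only on the
   supports. *)
have baK f : f \in A -> f = b (a f).
  move=> fA; apply/ffunP => m; rewrite ffunE -[LHS]mon_fun_seq.
  apply: (ext_of_ders (annA f fA)); last exact: size_mon_seq.
  move=> I z sI I5 sz; rewrite addms_empty5 // sol_famK; last exact: fam_vars.
  have vI : valid D (mask_of I) by rewrite -sI valid_mask_of.
  rewrite (famE (annA f fA)) ?size_mkseq // /canon_ders.
  exact: ders_canon (annA f fA) sI I5 sz.
have -> : A = b @: sols D.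
  apply/setP => f; apply/idP/imsetP => [fA|[x xs ->]]; last exact: bA.
  by exists (a f); [exact: aS|exact: baK].
by apply: card_in_imset => x y xs ys e; rewrite -(abK x xs) -(abK y ys) e.
Qed.

Theorem theorem3p9 (d : nat) (hd : (1 <= d)%N) :
  dimQP5 (4 * (2 ^ d - 1)) =
  (if d == 1 then 45 else if d == 2 then 190 else if d == 3 then 480
   else if d == 4 then 650 else 651)%N.
Proof. by case: d hd => // d _; rewrite dimQP5_deg. Qed.
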